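(* For every $N\ge2$, with $K_N,L_N,u_N,v_N$ as defined in the context, $$u_N=\frac1N\cot\frac{\pi}{2N},\qquad v_N=\frac1N\csc\frac{\pi}{2N},\qquad J(K_N,L_N)=\frac1{2N}\cot\frac{\pi}{4N}.$$ Consequently $J(K_N,L_N)$ increases with $N$ to $\frac2\pi$, and $$\frac2\pi-J(K_N,L_N)=\frac{\pi}{24N^2}+O(N^{-4})\qquad(N\to\infty).$$
   Context: For positive semidefinite matrices $K,L$ with $\operatorname{tr}(K+L)=1$, put $G=K+L$, $Q=K-L$ and $$J(K,L)=\operatorname{tr}(K^{1/2}L^{1/2})+\frac12\operatorname{tr}\left(G^{-1/2}QG^{-1/2}Q\right),$$ inverses being taken on $\operatorname{supp}G$. Let $\mathsf X,\mathsf Y,\mathsf Z$ be the Pauli matrices, and on $(\mathbb C^2)^{\otimes N}$ let $\mathsf X_j,\mathsf Y_j,\mathsf Z_j$ act in the $j$th tensor factor, the $N$ factors being indexed by $j=0,\dots,N-1$. Put $a_j=\mathsf X_0\cdots\mathsf X_{j-1}\mathsf Z_j$. Define $$\eta_{N,j}=\cos\theta_{N,j},\quad \theta_{N,j}=\frac{(j+1/2)\pi}{N},\qquad \gamma_{N,j}=\frac1{\sqrt N}\qquad(0\le j\le N-1),$$ $$G_N=2^{-N}\prod_{j=0}^{N-1}(I-\eta_{N,j}\mathsf X_j),\qquad R_N=\sum_{j=0}^{N-1}\gamma_{N,j}a_j,\qquad P_N=\frac{I+R_N}2 .$$ Here $G_N$ is positive definite of trace one and $R_N=R_N^*=R_N^{-1}$,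 so $P_N$ is an orthogonal projection. Put $$K_N=G_N^{1/2}P_NG_N^{1/2},\qquad L_N=G_N^{1/2}(I-P_N)G_N^{1/2},$$ $$u_N=2\operatorname{tr}(K_N^{1/2}L_N^{1/2}),\qquad v_N=\operatorname{tr}\left(R_NG_N^{1/2}R_NG_N^{1/2}\right).$$ *)

(* Defs.v *)
From mathcomp Require Import all_boot all_order all_algebra.
From mathcomp Require Import all_classical all_reals all_analysis.
From mathcomp Require Import complex mxtens.

Set Implicit Arguments.
Unset Strict Implicit.
Unset Printing Implicit Defensive.

Import Order.TTheory GRing.Theory Num.Theory.
Import numFieldNormedType.Exports.

Local Open Scope ring_scope.
Local Open Scope complex_scope.

Definition cot {R : realType} (x : R) : R := cos x / sin x.

Definition csc {R : realType} (x : R) : R := (sin x)^-1.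

Section FunctionalCalculus.
Variable C : numClosedFieldType.
Implicit Types n : nat.

(* [spectralmx A] is unitary and, for normal [A], diagonalizes [A] with
   eigenvalues [spectral_diag A]; so this is f(A) for normal [A], and it is
   only meaningful for such [A]. *)
Definition mxfun (f : C -> C) n (A : 'M[C]_n) : 'M[C]_n :=
  invmx (spectralmx A) *m diag_mx (map_mx f (spectral_diag A))
    *m spectralmx A.

Definition mxsqrt n (A : 'M[C]_n) : 'M[C]_n := mxfun sqrtC A.

(* Since [0^-1 = 0], the kernel of [A] is sent to 0: the inverse is taken on
   the support of [A]. *)
Definition mxsqrtV n (A : 'M[C]_n) : 'M[C]_n := mxfun (fun x => (sqrtC x)^-1) A.

(* Used only for positive semidefinite [K], [L] with [\tr (K + L) = 1]. *)
Definition J n (K L : 'M[C]_n) : C :=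
  let G := K + L in
  let Q := K - L in
  \tr (mxsqrt K *m mxsqrt L)
    + 2^-1 * \tr (mxsqrtV G *m Q *m mxsqrtV G *m Q).

End FunctionalCalculus.

Section Qubits.
Variable C : numClosedFieldType.

Definition pauliX : 'M[C]_2 := \matrix_(i, j) (i != j)%:R.

Definition pauliZ : 'M[C]_2 :=
  \matrix_(i, j) ((-1) ^+ i * (i == j)%:R).

(* qdim N = 2 ^ N, the dimension of the N-fold tensor power of C^2. *)
Fixpoint qdim (N : nat) : nat := if N is M.+1 then (qdim M * 2)%N else 1%N.

(* The tensor product of A 0, ..., A N.-1, in this order. *)
Fixpoint tensor (N : nat) (A : nat -> 'M[C]_2) : 'M[C]_(qdim N) :=
  if N is M.+1 then tensor M A *t A M else 1%:M.

Definition site (N : nat) (A : 'M[C]_2) (j : 'I_N) : 'M[C]_(qdim N) :=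
  tensor N (fun i => if i == j then A else 1%:M).

Definition X_ N (j : 'I_N) : 'M[C]_(qdim N) := site pauliX j.

Definition Z_ N (j : 'I_N) : 'M[C]_(qdim N) := site pauliZ j.

Definition a_ N (j : 'I_N) : 'M[C]_(qdim N) :=
  (\prod_(i < N | (i < j)%N) X_ i) *m Z_ j.

End Qubits.

Section Example.
Variable R : realType.
Implicit Types N : nat.

Definition theta N (j : 'I_N) : R := (j%:R + 2^-1) * pi / N%:R.

Definition eta N (j : 'I_N) : R := cos (theta j).

Definition gamma N (j : 'I_N) : R := (Num.sqrt N%:R)^-1.

Definition G_ N : 'M[R[i]]_(qdim N) :=
  2 ^- N *: \prod_(j < N) (1%:M - (eta j)%:C *: X_ R[i] j).

Definition R_ N : 'M[R[i]]_(qdim N) :=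
  \sum_(j < N) (gamma j)%:C *: a_ R[i] j.

Definition P_ N : 'M[R[i]]_(qdim N) := 2^-1 *: (1%:M + R_ N).

Definition K_ N : 'M[R[i]]_(qdim N) :=
  mxsqrt (G_ N) *m P_ N *m mxsqrt (G_ N).

Definition L_ N : 'M[R[i]]_(qdim N) :=
  mxsqrt (G_ N) *m (1%:M - P_ N) *m mxsqrt (G_ N).

Definition u_ N : R[i] := 2 * \tr (mxsqrt (K_ N) *m mxsqrt (L_ N)).

Definition v_ N : R[i] :=
  \tr (R_ N *m mxsqrt (G_ N) *m R_ N *m mxsqrt (G_ N)).

End Example.

(* Main.v *)
Require Import Defs.
From mathcomp Require Import all_boot all_order all_algebra.
From mathcomp Require Import all_classical all_reals all_analysis.
From mathcomp Require Import complex mxtens ring lra zify.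

(** The matrices a_j together with c_j = a_j X_j generate a Clifford algebra,
    and G_N is a Gaussian (free-fermion) element of it: with D = diag (eta_j)
    and a(f), c(f) the linear combinations with coefficient vector f,

      [G, a(f)] = {G, c(D f)},     [G, c(f)] = {G, a(D f)}.

    Everything about square roots is extracted from such relations.  If a
    positive definite A satisfies [A, p] = l {A, q} and [A, q] = l {A, p},
    then p + q and p - q are eigenvectors of x |-> A x A^-1 with eigenvalues
    (1 + l) / (1 - l) and its inverse.  The square root of A multiplies them
    by the square roots of these numbers, which gives the sandwich identity

      A^(1/2) p A^(1/2) = sqrt (1 - l^2) / 2 {A, p}.

    For A = G, p = a_j, l = eta_j it gives v_N = (1/N) sum_j sin theta_j.

    For u_N, write T = G^(1/2), P = (1 + R) / 2, P' = 1 - P, and pinch G to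
    E = (G + R G R) / 2.  Then E commutes with P and P G P = P E, so that, by
    uniqueness of positive roots, K^(1/2) = T E^(-1/2) P T, and L^(1/2) is the
    same with P'.  Hence u_N = 2 tr (E^(-1/2) P G P' E^(-1/2) G), where
    P G P' = - [G, R] P' / 2 and [G, R] = {E, c(D gamma)}.  The matrix E is
    again Gaussian, but with D compressed to the complement of gamma.  Once
    c(D gamma) is expanded in eigenvectors c(f_m) of the compressed relations
    for E, with eigenvalues l_m = cos (m pi / N), the sandwich identity turns
    E^(-1/2) [G, R] E^(-1/2) into a linear element c(..), and the trace becomes
    a scalar product: u_N = (1/N) sum_m sin (m pi / N).

    The eigenvectors are explicit because D = diag (cos theta_j) at the
    Chebyshev nodes acts on the discrete cosines e_k(j) = cos (k theta_j) as a
    path (D e_k = (e_(k+1) + e_(k-1)) / 2 with e_N = 0) and gamma is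
    proportional to e_0.  They are f_m = sum over odd k of sin (k m pi / N) e_k
    and its partner with k even.

    Finally J = (u_N + v_N) / 2 and cot y + csc y = cot (y / 2) give the closed
    form, and J = (2 / pi) x cot x at x = pi / (4 N).  The asymptotic claims
    follow from the monotonicity of x cot x on (0, pi / 2) and from its
    expansion 1 - x^2 / 3 + O(x^4). *)

Set Implicit Arguments.
Unset Strict Implicit.
Unset Printing Implicit Defensive.

Import Order.TTheory GRing.Theory Num.Theory.
Import numFieldNormedType.Exports.

Local Open Scope ring_scope.
Local Open Scope sesquilinear_scope.

(** * Functional calculus of hermitian matrices *)

Section Positive.
Variable C : numClosedFieldType.
Implicit Types (n : nat) (f g h : C -> C).

Definition qform n (A : 'M[C]_n) (v : 'rV[C]_n) : C := (v *m A *m v ^t*) 0 0.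

Definition psd n (A : 'M[C]_n) := A ^t* = A /\ forall v, 0 <= qform A v.

Definition pd n (A : 'M[C]_n) :=
  A ^t* = A /\ forall v, v != 0 -> 0 < qform A v.

Lemma ctM m n p (A : 'M[C]_(m, n)) (B : 'M[C]_(n, p)) :
  (A *m B) ^t* = B ^t* *m A ^t*.
Proof. by rewrite trmx_mul map_mxM. Qed.

Lemma herm_normal n (A : 'M[C]_n) : A ^t* = A -> A \is normalmx.
Proof. by move=> hA; apply/normalmxP; rewrite hA. Qed.

Lemma pd_psd n (A : 'M[C]_n) : pd A -> psd A.
Proof.
case=> hA pA; split=> // v; have [->|/pA/ltW//] := eqVneq v 0.
by rewrite /qform !mul0mx mxE.
Qed.

Lemma mxfun_id n (A : 'M[C]_n) : A ^t* = A -> mxfun id A = A.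
Proof.
move=> /herm_normal/orthomx_spectralP hA; rewrite /mxfun [RHS]hA.
by congr (_ *m _ *m _); congr diag_mx; apply/rowP=> i; rewrite mxE.
Qed.

(** An eigenvalue is the value of the form at a unit eigenvector, so the sign
    of the form controls the sign of the spectrum. *)
Lemma spectral_diagE n (A : 'M[C]_n) i : A ^t* = A ->
  spectral_diag A 0 i = qform A (row i (spectralmx A)).
Proof.
move=> /herm_normal/orthomx_spectralP hA; set U := spectralmx A in hA *.
have uU : U \is unitarymx := spectral_unitarymx A.
have D : U *m A *m U ^t* = diag_mx (spectral_diag A).
  rewrite [in LHS]hA !mulmxA mulmxV ?unitarymx_unit // mul1mx.
  by rewrite mulmxtVK.
have := congr1 (fun M : 'M[C]_n => M i i) D; rewrite !mxE eqxx mulr1n => <-.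
rewrite /qform mxE; apply: eq_bigr => k _; rewrite !mxE; congr (_ * _).
by apply: eq_bigr => l _; rewrite !mxE.
Qed.

Lemma psd_spectral n (A : 'M[C]_n) i : psd A -> 0 <= spectral_diag A 0 i.
Proof. by case=> hA pA; rewrite spectral_diagE. Qed.

Lemma pd_spectral n (A : 'M[C]_n) i : pd A -> 0 < spectral_diag A 0 i.
Proof.
case=> hA pA; rewrite spectral_diagE //; apply: pA.
have uU : row_free (spectralmx A).
  by rewrite row_free_unit unitarymx_unit ?spectral_unitarymx.
apply: contraTneq isT => e.
have /(row_free_inj uU)/eqP : delta_mx 0 i *m spectralmx A = 0 *m spectralmx A :> 'rV_n.
  by rewrite -rowE e mul0mx.
by move=> /eqP/rowP/(_ i); rewrite !mxE !eqxx => /eqP; rewrite oner_eq0.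
Qed.

(** In the two eigenbases the hypothesis reads h1 (a_i) W_ij = W_ij h2 (b_j):
    wherever W_ij is nonzero the two numbers agree, hence so do their images
    under f.  This single fact gives the uniqueness of square roots, the
    commutation of f(A) with the commutant of A, and the scaling rule for
    eigenvectors of the conjugation by A. *)
Lemma mxfun_intertwine n (A B X : 'M[C]_n) f h1 h2 :
  mxfun h1 A *m X = X *m mxfun h2 B ->
  mxfun (f \o h1) A *m X = X *m mxfun (f \o h2) B.
Proof.
rewrite /mxfun; set U := spectralmx A; set V := spectralmx B.
have uU : U \in unitmx by rewrite unitarymx_unit ?spectral_unitarymx.
have uV : V \in unitmx by rewrite unitarymx_unit ?spectral_unitarymx.
move=> e; pose W := U *m X *m invmx V.
have red g1 g2 :
    invmx U *m diag_mx (map_mx g1 (spectral_diag A)) *m U *m X =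
    X *m (invmx V *m diag_mx (map_mx g2 (spectral_diag B)) *m V) <->
    diag_mx (map_mx g1 (spectral_diag A)) *m W =
    W *m diag_mx (map_mx g2 (spectral_diag B)).
  move: (diag_mx _) (diag_mx _) => D1 D2; rewrite /W; split=> e1.
    have := congr1 (fun M => U *m M *m invmx V) e1.
    by rewrite !mulmxA mulmxV // mul1mx => ->; rewrite mulmxK.
  have := congr1 (fun M => invmx U *m M *m V) e1.
  by rewrite !mulmxA mulVmx // mul1mx mulmxKV.
move/red: e => e; apply/red; clear red; clearbody W; apply/matrixP => i j.
move/matrixP: e => /(_ i j); rewrite !mul_diag_mx !mul_mx_diag !mxE /=.
have [->|nz] := eqVneq (W i j) 0; first by rewrite !mulr0 !mul0r.
by rewrite ![_ * W i j]mulrC => /(mulfI nz) ->.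
Qed.

Lemma mxfunM n (A : 'M[C]_n) f g :
  mxfun f A *m mxfun g A = mxfun (fun x => f x * g x) A.
Proof.
rewrite /mxfun; set U := spectralmx A.
have uU : U \in unitmx by rewrite unitarymx_unit ?spectral_unitarymx.
rewrite !mulmxA mulmxK // -[in LHS](mulmxA (invmx U)) mulmx_diag.
by congr (_ *m diag_mx _ *m _); apply/rowP=> i; rewrite !mxE.
Qed.

Lemma eq_mxfun n (A : 'M[C]_n) f g :
  (forall i, f (spectral_diag A 0 i) = g (spectral_diag A 0 i)) ->
  mxfun f A = mxfun g A.
Proof.
by move=> e; congr (_ *m diag_mx _ *m _); apply/rowP=> i; rewrite !mxE.
Qed.

Lemma mxfun1 n (A : 'M[C]_n) : mxfun (fun=> 1) A = 1%:M.
Proof.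
rewrite /mxfun (_ : map_mx _ _ = const_mx 1); last first.
  by apply/rowP=> i; rewrite !mxE.
by rewrite diag_const_mx mulmx1 mulVmx // unitarymx_unit ?spectral_unitarymx.
Qed.

Lemma mxfun_adj n (A : 'M[C]_n) f :
  (forall i, f (spectral_diag A 0 i) \is Num.real) -> (mxfun f A) ^t* = mxfun f A.
Proof.
move=> rf; rewrite /mxfun invmx_unitary ?spectral_unitarymx // !ctM trmxCK.
rewrite mulmxA; congr (_ *m _ *m _); rewrite tr_diag_mx.
by apply/matrixP=> i j; rewrite !mxE rmorphMn /= conj_Creal.
Qed.

Lemma qform_mxfun n (A : 'M[C]_n) f v : let w := v *m (spectralmx A) ^t* in
  qform (mxfun f A) v = \sum_i f (spectral_diag A 0 i) * (w 0 i * (w 0 i)^*).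
Proof.
move=> w; have -> : qform (mxfun f A) v =
    (w *m diag_mx (map_mx f (spectral_diag A)) *m w ^t*) 0 0.
  rewrite /qform /mxfun invmx_unitary ?spectral_unitarymx // /w ctM trmxCK.
  by rewrite !mulmxA.
rewrite mul_mx_diag mxE; apply: eq_bigr => i _; rewrite !mxE.
by rewrite mulrA; congr (_ * _); rewrite mulrC.
Qed.

Lemma mxfun_pd n (A : 'M[C]_n) f :
  (forall i, 0 < f (spectral_diag A 0 i)) -> pd (mxfun f A).
Proof.
move=> f0; split; first by apply: mxfun_adj => i; apply: gtr0_real.
move=> v nz; rewrite qform_mxfun; set w := v *m _.
have : w != 0.
  apply: contraNneq nz => w0; have := congr1 (mulmx^~ (spectralmx A)) w0.
  by rewrite mul0mx mulmxKtV ?spectral_unitarymx // => ->.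
case/rV0Pn => i wi; rewrite (bigD1 i) //= ltr_pwDl //.
  by rewrite mulr_gt0 // mul_conjC_gt0.
by apply: sumr_ge0 => k _; rewrite mulr_ge0 ?mul_conjC_ge0 // ltW.
Qed.

Lemma mxsqrt_pd n (A : 'M[C]_n) : pd A -> pd (mxsqrt A).
Proof.
by move=> pA; apply: mxfun_pd => i; rewrite sqrtC_gt0 pd_spectral.
Qed.

Lemma mxsqrtK n (A : 'M[C]_n) : A ^t* = A -> mxsqrt A *m mxsqrt A = A.
Proof.
move=> hA; rewrite mxfunM -[RHS]mxfun_id //; apply: eq_mxfun => i.
by rewrite -expr2 sqrtCK.
Qed.

Lemma mxsqrtV_pd n (A : 'M[C]_n) : pd A -> pd (mxsqrtV A).
Proof.
by move=> pA; apply: mxfun_pd => i; rewrite invr_gt0 sqrtC_gt0 pd_spectral.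
Qed.

Lemma mxsqrtVl n (A : 'M[C]_n) : pd A -> mxsqrtV A *m mxsqrt A = 1%:M.
Proof.
move=> pA; rewrite mxfunM -(mxfun1 A); apply: eq_mxfun => i.
by rewrite mulVf // sqrtC_eq0 gt_eqF // pd_spectral.
Qed.

Lemma mxsqrtVr n (A : 'M[C]_n) : pd A -> mxsqrt A *m mxsqrtV A = 1%:M.
Proof. by move=> /mxsqrtVl/mulmx1C. Qed.

(** [mxfun_intertwine] with X = 1: B is a function of itself and B B is its
    square, and the square root undoes the square on a nonnegative spectrum. *)
Lemma mxsqrt_unique n (B : 'M[C]_n) : psd B -> mxsqrt (B *m B) = B.
Proof.
move=> pB; have [hB _] := pB.
have hBB : (B *m B) ^t* = B *m B by rewrite ctM hB.
have /(mxfun_intertwine sqrtC) :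
    mxfun id (B *m B) *m 1%:M = 1%:M *m mxfun (fun x => x * x) B.
  by rewrite mulmx1 mul1mx mxfun_id // -mxfunM mxfun_id.
rewrite mulmx1 mul1mx => e; rewrite -[RHS]mxfun_id //.
apply: etrans e _.
by apply: eq_mxfun => i /=; rewrite -expr2 sqrCK // psd_spectral.
Qed.

Lemma mxfunZ n (A : 'M[C]_n) f mu :
  mxfun (fun x => mu * f x) A = mu *: mxfun f A.
Proof.
rewrite /mxfun scalemxAl scalemxAr -linearZ /=.
by congr (_ *m diag_mx _ *m _); apply/rowP=> i; rewrite !mxE.
Qed.

(** A root scales an eigenvector X of the conjugation by A by the root of its
    eigenvalue: compare A with mu A in [mxfun_intertwine]. *)
Lemma mxsqrt_scaled_comm n (A X : 'M[C]_n) (mu : C) : A ^t* = A -> 0 <= mu ->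
  A *m X = mu *: (X *m A) -> mxsqrt A *m X = sqrtC mu *: (X *m mxsqrt A).
Proof.
move=> hA mu0 e.
have /(mxfun_intertwine sqrtC) :
    mxfun id A *m X = X *m mxfun (fun x => mu * x) A.
  by rewrite mxfun_id // e [in RHS]mxfunZ mxfun_id // scalemxAr.
move=> e2; apply: etrans e2 _; rewrite scalemxAr -mxfunZ; congr (_ *m _).
by apply: eq_mxfun => i /=; rewrite rootCMl.
Qed.

Lemma mxfun_comm n (A X : 'M[C]_n) f : A ^t* = A ->
  A *m X = X *m A -> mxfun f A *m X = X *m mxfun f A.
Proof.
move=> hA; rewrite -{1 2}(mxfun_id hA) => /(mxfun_intertwine f).
exact.
Qed.

End Positive.

(** * Square roots and linear commutation relations *)

Section MxRing.
Variables (C : numClosedFieldType) (n : nat).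
Implicit Types A B P : 'M[C]_n.

Lemma mxZl k A B : (k *: A) * B = k *: (A * B).
Proof. by rewrite -mulmxE -scalemxAl. Qed.

Lemma mxZr k A B : A * (k *: B) = k *: (A * B).
Proof. by rewrite -mulmxE -scalemxAr. Qed.

Lemma trM A B : \tr (A * B) = \tr (B * A).
Proof. exact: mxtrace_mulC. Qed.

Lemma psd_congr A B : psd A -> psd (B * A * B ^t*).
Proof.
case=> hA pA; split; first by rewrite -!mulmxE !ctM trmxCK hA mulmxA.
by move=> v; rewrite /qform -!mulmxE !mulmxA -mulmxA -ctM; apply: pA.
Qed.

Lemma pd_congr A B : B \in unitmx -> pd A -> pd (B * A * B ^t*).
Proof.
move=> uB [hA pA]; split; first by rewrite -!mulmxE !ctM trmxCK hA mulmxA.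
move=> v nz; rewrite /qform -!mulmxE !mulmxA -mulmxA -ctM; apply: pA.
by apply: contraNneq nz => e; rewrite -(mulmxK uB v) e mul0mx.
Qed.

Lemma qformD A B v : qform (A + B) v = qform A v + qform B v.
Proof. by rewrite /qform mulmxDr mulmxDl mxE. Qed.

Lemma qformZ k A v : qform (k *: A) v = k * qform A v.
Proof. by rewrite /qform -scalemxAr -scalemxAl mxE. Qed.

Lemma ctD A B : (A + B) ^t* = A ^t* + B ^t*.
Proof. by rewrite !raddfD. Qed.

Lemma ctZ k A : (k *: A) ^t* = k^* *: A ^t*.
Proof. by apply/matrixP=> i j; rewrite !mxE rmorphM. Qed.

Lemma ct_sum (I : finType) (F : I -> 'M[C]_n) :
  (\sum_i F i) ^t* = \sum_i (F i) ^t*.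
Proof.
apply/matrixP=> i j; rewrite !mxE !summxE rmorph_sum /=.
by apply: eq_bigr => k _; rewrite !mxE.
Qed.

Lemma pdD A B : pd A -> pd B -> pd (A + B).
Proof.
move=> [hA pA] [hB pB]; split; first by rewrite ctD hA hB.
by move=> v nz; rewrite qformD addr_gt0 ?pA ?pB.
Qed.

Lemma pdZ k A : 0 < k -> pd A -> pd (k *: A).
Proof.
move=> k0 [hA pA]; split; first by rewrite ctZ hA conj_Creal ?gtr0_real.
by move=> v nz; rewrite qformZ mulr_gt0 ?pA.
Qed.

(** To derive an equation as a linear combination of others: it is enough that
    both equations have the same difference of sides. *)
Lemma subr_sub_eq (V : zmodType) (u v s t : V) : s = t -> u - v = s - t -> u = v.
Proof. by move=> ->; rewrite subrr => /eqP; rewrite subr_eq0 => /eqP. Qed.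

(** Here A x = mu x A with mu = (1 + l) / (1 - l), so A^(1/2) x A^(1/2) is
    sqrt mu x A while A x + x A is (mu + 1) x A; the ratio sqrt mu / (mu + 1)
    is invariant under mu -> 1 / mu, that is l -> - l. *)
Lemma sandwich_eigen A (x : 'M[C]_n) (l : C) : pd A -> -1 < l < 1 ->
  (1 - l) *: (A * x) = (1 + l) *: (x * A) ->
  mxsqrt A * x * mxsqrt A = (sqrtC (1 - l ^+ 2) / 2) *: (A * x + x * A).
Proof.
move=> pA /andP[l1 l2] e; have [hA _] := pA.
have m0 : 0 < 1 - l by rewrite subr_gt0.
have p0 : 0 < 1 + l by rewrite -ltrBlDl sub0r.
have {e} e : A * x = ((1 + l) / (1 - l)) *: (x * A).
  by rewrite mulrC -scalerA -e scalerA mulVf ?gt_eqF // scale1r.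
have mu0 : 0 <= (1 + l) / (1 - l) by rewrite divr_ge0 ?ltW.
rewrite -!mulmxE (mxsqrt_scaled_comm hA mu0 e) -scalemxAl -mulmxA mxsqrtK //.
rewrite !mulmxE e -[X in _ *: (_ + X)]scale1r -scalerDl scalerA.
congr (_ *: _).
have -> : 1 - l ^+ 2 = (1 + l) / (1 - l) * (1 - l) ^+ 2.
  by field; rewrite gt_eqF.
rewrite [in RHS]rootCMl // sqrCK ?(ltW m0) //; field; rewrite gt_eqF //.
Qed.

(** The sandwich identity: p + q and p - q fall under [sandwich_eigen] with l
    and - l, for the same constant. *)
Lemma sandwich A (p q : 'M[C]_n) (l : C) : pd A -> -1 < l < 1 ->
  A * p - p * A = l *: (A * q + q * A) ->
  A * q - q * A = l *: (A * p + p * A) ->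
  mxsqrt A * p * mxsqrt A = (sqrtC (1 - l ^+ 2) / 2) *: (A * p + p * A).
Proof.
move=> pA l1 e1 e2.
have ex : (1 - l) *: (A * (p + q)) = (1 + l) *: ((p + q) * A).
  rewrite !(mulrDl, mulrDr); move: e1 e2.
  move: (A * p) (A * q) (p * A) (q * A) => B1 B2 B3 B4 /matrixP e1 /matrixP e2.
  apply/matrixP=> i j; have := congr2 +%R (e1 i j) (e2 i j).
  by rewrite !mxE => /subr_sub_eq; apply; ring.
have ey : (1 - - l) *: (A * (p - q)) = (1 + - l) *: ((p - q) * A).
  rewrite !(mulrDl, mulrDr); move: e1 e2; rewrite !(mulNr, mulrN).
  move: (A * p) (A * q) (p * A) (q * A) => B1 B2 B3 B4 /matrixP e1 /matrixP e2.
  apply/matrixP=> i j; have := congr2 (fun x y => x - y) (e1 i j) (e2 i j).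
  by rewrite !mxE => /subr_sub_eq; apply; ring.
have l1' : -1 < - l < 1 by rewrite ltrNl opprK ltrNl andbC.
have := congr2 +%R (sandwich_eigen pA l1 ex) (sandwich_eigen pA l1' ey).
rewrite sqrrN -scalerDr -mulrDl -mulrDr.
have two : (2 : C) != 0 by rewrite pnatr_eq0.
have -> : p + q + (p - q) = 2%:R *: p.
  by rewrite addrACA subrr addr0 scaler_nat mulr2n.
rewrite mxZr mxZl [X in _ = _ *: X](_ : _ = 2%:R *: (A * p + p * A)).
  by rewrite scalerA => e; apply: (scalerI two); rewrite e scalerA mulrC.
rewrite addrACA -!(mulrDl, mulrDr) addrACA subrr addr0 -mulr2n -scaler_nat.
by rewrite mxZr mxZl scalerDr.
Qed.
End MxRing.

(** * Clifford systems and product states *)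

Lemma prod_pull (A : pzRingType) (I : eqType) (r : seq I) j (F : I -> A) :
  uniq r -> j \in r -> (forall i k, F i * F k = F k * F i) ->
  \prod_(i <- r) F i = F j * \prod_(i <- r | i != j) F i.
Proof.
move=> + + FC; elim: r => [//|k r IHr] /= /andP[kr ur].
rewrite !big_cons inE; have [->|jk] /= := eqVneq j k.
  move=> _; congr (_ * _); rewrite [LHS]big_seq_cond [RHS]big_seq_cond.
  apply: eq_bigl => i; rewrite andbT; case ir: (i \in r) => //=.
  by apply/esym; apply: contraNneq kr => <-.
by move=> jr; rewrite IHr // !mulrA FC.
Qed.

(** The algebraic content of the spin chain: the a_i anticommute with each
    other, and a_i flips the sign of X_i alone. *)
Record clifford (C : numClosedFieldType) n N (X a : 'I_N -> 'M[C]_n) : Prop :=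
  Clifford {
    cliffXC : forall i j, X i * X j = X j * X i;
    cliffXX : forall i, X i * X i = 1;
    cliffX_herm : forall i, (X i) ^t* = X i;
    cliffaa : forall i, a i * a i = 1;
    cliffa_herm : forall i, (a i) ^t* = a i;
    cliffaA : forall i j, i != j -> a i * a j = - (a j * a i);
    cliffaX : forall i, a i * X i = - (X i * a i);
    cliffaXC : forall i j, i != j -> a i * X j = X j * a i
  }.

Lemma tr_anticomm (C : numClosedFieldType) n (U B : 'M[C]_n) :
  U * U = 1 -> U * B = - (B * U) -> \tr B = 0.
Proof.
move=> UU UB; have e : \tr B = - \tr B.
  have := congr1 (fun M => \tr (M * U)) UB.
  by rewrite mulNr raddfN /= -mulrA trM -!mulrA UU mulr1 => <-.
move/eqP: e; rewrite -subr_eq0 opprK -mulr2n mulrn_eq0 /=.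
by move/eqP.
Qed.

(** States satisfying the linear relations of a free-fermion state whose modes
    are the pairs (a_j, a_j X_j).  The last field is a parity condition. *)
Record gaussian (C : numClosedFieldType) n N (X a : 'I_N -> 'M[C]_n)
    (eta : 'I_N -> C) (G : 'M[C]_n) : Prop := Gaussian {
  gauss_pd : pd G;
  gauss_tr : \tr G = 1;
  gauss_a : forall j, G * a j - a j * G =
    eta j *: (G * (a j * X j) + (a j * X j) * G);
  gauss_c : forall j, G * (a j * X j) - (a j * X j) * G =
    eta j *: (G * a j + a j * G);
  gauss_tr_c : forall j, \tr (G * (a j * X j)) = 0
}.

Section Clifford.
Variables (C : numClosedFieldType) (n N : nat) (X a : 'I_N -> 'M[C]_n).
Hypothesis cl : clifford X a.
Local Notation XC := (cliffXC cl).
Local Notation X2 := (cliffXX cl).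
Local Notation a2 := (cliffaa cl).
Local Notation aA := (cliffaA cl).
Local Notation aX := (cliffaX cl).
Local Notation aXC := (cliffaXC cl).
Implicit Types f h : 'I_N -> C.

Definition c_gen i := a i * X i.
Definition a_lin f : 'M[C]_n := \sum_i f i *: a i.
Definition c_lin f : 'M[C]_n := \sum_i f i *: c_gen i.

Lemma a_acomm i j : a i * a j + a j * a i = (2 *+ (i == j)) *: (1 : 'M[C]_n).
Proof.
have [->|ij] := eqVneq i j; last by rewrite aA // addNr scale0r.
by rewrite a2 mulr1n scaler_nat.
Qed.

Lemma c_acomm i j :
  c_gen i * c_gen j + c_gen j * c_gen i = (- 2 *+ (i == j)) *: (1 : 'M[C]_n).
Proof.
rewrite /c_gen; have [->|ij] := eqVneq i j; last first.
  rewrite mulr0n scale0r -!mulrA !(mulrA (X _)) -aXC ?ij 1?eq_sym //.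
  by rewrite -aXC // 1?eq_sym // -!(mulrA (a _) (X _)) !(mulrA (a _) (a _))
    (XC j) -mulrDl aA // addNr mul0r.
have -> : a j * X j * (a j * X j) = -1.
  by rewrite [in X in X * _]aX mulNr mulrA -(mulrA (X j)) a2 mulr1 X2.
by rewrite mulr1n scaleNr scaler_nat -opprD.
Qed.

Lemma ac_acomm i j : a i * c_gen j + c_gen j * a i = 0.
Proof.
rewrite /c_gen; have [->|ij] := eqVneq i j.
  by rewrite -mulrA -(opprK (X j * a j)) -aX mulrN addrN.
by rewrite -mulrA -aXC // !mulrA -mulrDl aA // addNr mul0r.
Qed.

Lemma lin_acomm (B D : 'I_N -> 'M[C]_n) f h :
  (\sum_i f i *: B i) * (\sum_j h j *: D j) +
  (\sum_j h j *: D j) * (\sum_i f i *: B i) =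
  \sum_i \sum_j (f i * h j) *: (B i * D j + D j * B i).
Proof.
rewrite mulr_suml [X in _ + X]mulr_sumr -big_split; apply: eq_bigr => i _ /=.
rewrite mulr_sumr mulr_suml -big_split; apply: eq_bigr => j _ /=.
by rewrite !(mxZl, mxZr) !scalerA scalerDr [h j * _]mulrC.
Qed.

Lemma a_lin_acomm f h :
  a_lin f * a_lin h + a_lin h * a_lin f = (2 * \sum_i f i * h i) *: (1 : 'M[C]_n).
Proof.
rewrite lin_acomm mulr_sumr scaler_suml; apply: eq_bigr => i _.
rewrite (bigD1 i) //= big1 ?addr0 => [|j ji].
  by rewrite a_acomm eqxx mulr1n scalerA mulrC.
by rewrite a_acomm eq_sym (negPf ji) scale0r scaler0.
Qed.

Lemma c_lin_acomm f h :
  c_lin f * c_lin h + c_lin h * c_lin f = - (2 * \sum_i f i * h i) *: (1 : 'M[C]_n).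
Proof.
rewrite lin_acomm mulr_sumr -sumrN scaler_suml; apply: eq_bigr => i _.
rewrite (bigD1 i) //= big1 ?addr0 => [|j ji].
  by rewrite c_acomm eqxx mulr1n scalerA mulrN [_ * 2]mulrC.
by rewrite c_acomm eq_sym (negPf ji) scale0r scaler0.
Qed.

Lemma ac_lin_acomm f h : a_lin f * c_lin h + c_lin h * a_lin f = 0.
Proof.
rewrite lin_acomm big1 // => i _; rewrite big1 // => j _.
by rewrite ac_acomm scaler0.
Qed.

Variable eta : 'I_N -> C.
Hypothesis eta1 : forall j, -1 < eta j < 1.

Let g j := 1 - eta j *: X j.

Definition prodG := n%:R^-1 *: \prod_j g j.

Lemma gC i j : g i * g j = g j * g i.
Proof.
have cX : GRing.comm (eta i *: X i) (eta j *: X j).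
  by rewrite /GRing.comm !(mxZl, mxZr) XC !scalerA mulrC.
apply: commrB; [exact: commr1|apply: commr_sym].
by apply: commrB; [exact: commr1|apply: commr_sym].
Qed.

(** Only the j-th factor of the product sees a_j and X_j, so relations for a
    single factor carry over to the whole state. *)
Lemma prodG_factor j : exists Y : 'M[C]_n,
  [/\ prodG = g j * Y, Y * a j = a j * Y & Y * X j = X j * Y].
Proof.
exists (n%:R^-1 *: \prod_(i < N | i != j) g i); split.
- by rewrite mxZr /prodG (@prod_pull _ _ _ j) ?index_enum_uniq ?mem_index_enum //; apply: gC.
- rewrite mxZl mxZr; congr (_ *: _); apply/esym/commr_prod => i ij.
  apply: commrB; first exact: commr1.
  by rewrite /GRing.comm mxZl mxZr aXC // eq_sym.
- rewrite mxZl mxZr; congr (_ *: _); apply/esym/commr_prod => i ij.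
  apply: commrB; first exact: commr1.
  by rewrite /GRing.comm mxZl mxZr XC.
Qed.

Lemma Xc j : X j * c_gen j = - a j.
Proof. by rewrite /c_gen mulrA -[X j * a j]opprK -aX mulNr -mulrA X2 mulr1. Qed.

Lemma Xa j : X j * a j = - c_gen j.
Proof. by rewrite /c_gen aX opprK. Qed.

Lemma cX j : c_gen j * X j = a j.
Proof. by rewrite /c_gen -mulrA X2 mulr1. Qed.

Lemma g_a j : g j * a j - a j * g j = eta j *: (g j * c_gen j + c_gen j * g j).
Proof.
rewrite /g !(mulrBl, mulrBr) !(mxZl, mxZr) Xa Xc cX !mul1r !mulr1.
rewrite -/(c_gen j); move: (a j) (c_gen j) => x y.
by apply/matrixP=> i k; rewrite !mxE; ring.
Qed.

Lemma g_c j : g j * c_gen j - c_gen j * g j = eta j *: (g j * a j + a j * g j).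
Proof.
rewrite /g !(mulrBl, mulrBr) !(mxZl, mxZr) Xa Xc cX !mul1r !mulr1.
rewrite -/(c_gen j); move: (a j) (c_gen j) => x y.
by apply/matrixP=> i k; rewrite !mxE; ring.
Qed.

Lemma prodG_comm_a j :
  prodG * a j - a j * prodG = eta j *: (prodG * c_gen j + c_gen j * prodG).
Proof.
have [Y [-> Ya YX]] := prodG_factor j.
have Yc : Y * c_gen j = c_gen j * Y by rewrite /c_gen mulrA Ya -mulrA YX mulrA.
have := g_a j; move: (c_gen j) Yc => c Yc e.
by rewrite -!mulrA Ya Yc !mulrA -mulrBl -mulrDl e mxZl.
Qed.

Lemma prodG_comm_c j :
  prodG * c_gen j - c_gen j * prodG = eta j *: (prodG * a j + a j * prodG).
Proof.
have [Y [-> Ya YX]] := prodG_factor j.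
have Yc : Y * c_gen j = c_gen j * Y by rewrite /c_gen mulrA Ya -mulrA YX mulrA.
have := g_c j; move: (c_gen j) Yc => c Yc e.
by rewrite -!mulrA Ya Yc !mulrA -mulrBl -mulrDl e mxZl.
Qed.

Lemma tr_prodG_c j : \tr (prodG * c_gen j) = 0.
Proof.
have GX : prodG * X j = X j * prodG.
  have [Y [-> Ya YX]] := prodG_factor j; rewrite -mulrA YX !mulrA; congr (_ * _).
  by rewrite /g mulrBl mulrBr mxZl mxZr mul1r mulr1.
apply: (tr_anticomm (X2 j)); by rewrite mulrA -GX -mulrA Xc -mulrA cX mulrN.
Qed.

Lemma tr_prod_g (r : seq 'I_N) : uniq r -> \tr (\prod_(j <- r) g j) = n%:R.
Proof.
elim: r => [|j r IHr] /=; first by rewrite big_nil mxtrace1.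
case/andP=> jr ur; rewrite big_cons /g mulrBl mul1r mxZl raddfB /= IHr //.
set W := \prod_(_ <- _) _.
have Wa : a j * W = W * a j.
  rewrite /W big_seq; apply: commr_prod => i ir.
  apply: commrB; first exact: commr1.
  by rewrite /GRing.comm mxZl mxZr aXC //; apply: contraNneq jr => ->.
rewrite mxtraceZ; suff -> : \tr (X j * W) = 0 by rewrite mulr0 subr0.
apply: (tr_anticomm (a2 j)).
by rewrite mulrA aX mulNr -!mulrA Wa.
Qed.

Hypothesis n0 : (0 < n)%N.

Lemma tr_prodG : \tr prodG = 1.
Proof.
by rewrite /prodG mxtraceZ tr_prod_g ?index_enum_uniq // mulVf // pnatr_eq0 -lt0n.
Qed.

(** Each factor is the square of a hermitian invertible al - be X_j commuting
    with the rest, so adding a factor is a congruence. *)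
Lemma prod_g_pd (r : seq 'I_N) : pd (\prod_(j <- r) g j).
Proof.
elim: r => [|j r IHr].
  rewrite big_nil; split; first by rewrite trmx1 map_mx1.
  by move=> v nz; rewrite /qform mulmx1 -dotmxE; apply: dotmx_is_dotmx.
rewrite big_cons; set W := \prod_(_ <- _) _ in IHr *.
have WX : X j * W = W * X j.
  apply: commr_prod => i _; apply: commrB; first exact: commr1.
  by rewrite /GRing.comm mxZl mxZr XC.
have /andP[e1 e2] := eta1 j.
have p0 : 0 < 1 + eta j by rewrite -ltrBlDl sub0r.
have m0 : 0 < 1 - eta j by rewrite subr_gt0.
pose p := sqrtC (1 + eta j); pose m := sqrtC (1 - eta j).
have pp : p * p = 1 + eta j by rewrite -expr2 sqrtCK.
have mm : m * m = 1 - eta j by rewrite -expr2 sqrtCK.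
have p1 : 0 < p by rewrite sqrtC_gt0.
have m1 : 0 < m by rewrite sqrtC_gt0.
(* al + be and al - be are the roots of the eigenvalues 1 + eta and 1 - eta
   of the factor. *)
pose al := (p + m) / 2; pose be := (p - m) / 2.
pose Y : 'M[C]_n := al *: (1 : 'M[C]_n) - be *: X j.
have hY : Y ^t* = Y.
  rewrite /Y; apply/matrixP=> i k; have /matrixP/(_ i k) := cliffX_herm cl j.
  rewrite !mxE rmorphB !rmorphM /= !rmorphMn /= rmorph1 => ->; rewrite [k == i]eq_sym.
  by rewrite !rmorphD rmorphN /= !conj_Creal ?gtr0_real // ?invr_gt0 ?ltr0n //.
have uY : Y \in unitmx.
  have e : Y *m ((p * m)^-1 *: (al *: (1 : 'M[C]_n) + be *: X j)) = 1%:M.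
    rewrite mulmxE mxZr /Y !(mulrBl, mulrDr) !(mxZl, mxZr) X2 !mul1r !mulr1.
    rewrite -[1%:M]/(1 : 'M[C]_n).
    move: (1 : 'M[C]_n) (X j) => x y; apply/matrixP=> i k; rewrite !mxE /al /be.
    by field; rewrite !gt_eqF.
  by have [] := mulmx1_unit e.
have -> : g j * W = Y * W * Y ^t*.
  rewrite hY -mulrA; have -> : W * Y = Y * W.
    by rewrite /Y mulrBl mulrBr !(mxZl, mxZr) WX mul1r mulr1.
  rewrite mulrA; congr (_ * _); rewrite /g /Y !(mulrBl, mulrBr).
  rewrite !(mxZl, mxZr) X2 !mul1r !mulr1 -?[1%:M]/(1 : 'M[C]_n).
  move: (1 : 'M[C]_n) (X j) => x y; apply/matrixP=> i k; rewrite !mxE /al /be.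
  apply: (subr_sub_eq (congr2
    (fun s t => s * (x i k - y i k) / 2 + t * (x i k + y i k) / 2)
    (esym pp) (esym mm))).
  by field.
exact: pd_congr.
Qed.

Lemma prodG_pd : pd prodG.
Proof. by apply: pdZ (prod_g_pd _); rewrite invr_gt0 ltr0n. Qed.

Lemma prodG_gaussian : gaussian X a eta prodG.
Proof.
split; [exact: prodG_pd|exact: tr_prodG|exact: prodG_comm_a
  |exact: prodG_comm_c|exact: tr_prodG_c].
Qed.

End Clifford.

(** * Measuring a Gaussian state *)

Section ConjRing.
Variable A : pzRingType.
Implicit Types G R x y : A.

(** Conjugating G by an involution R that anticommutes with x changes the sign
    of the bracket of G with x; this is how relations for G become relations
    for the pinched state (G + R G R) / 2. *)
Lemma conj_comm R G x : R * R = 1 -> R * x = - (x * R) ->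
  R * G * R * x - x * (R * G * R) = - (R * (G * x - x * G) * R).
Proof.
move=> R_invol Rx; have xR : x * R = - (R * x) by rewrite Rx opprK.
rewrite mulrBr mulrBl opprB -!mulrA Rx !(mulrN, mulNr) addrC !mulrA.
by rewrite xR !mulNr opprK.
Qed.

Lemma conj_acomm R G x : R * R = 1 -> R * x = - (x * R) ->
  R * G * R * x + x * (R * G * R) = - (R * (G * x + x * G) * R).
Proof.
move=> R_invol Rx; have xR : x * R = - (R * x) by rewrite Rx opprK.
rewrite mulrDr mulrDl opprD -!mulrA Rx !(mulrN, mulNr) !mulrA.
by rewrite xR !mulNr.
Qed.

End ConjRing.

Section Measured.
Variables (C : numClosedFieldType) (n N : nat) (X a : 'I_N -> 'M[C]_n).
Hypothesis cl : clifford X a.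
Variables (eta gam : 'I_N -> C).
Hypothesis eta1 : forall j, -1 < eta j < 1.
Hypothesis gam_real : forall j, gam j \is Num.real.
Hypothesis gam1 : \sum_j gam j * gam j = 1.

Local Notation a_lin := (a_lin a).
Local Notation c_lin := (c_lin X a).
Local Notation c_gen := (c_gen X a).
Variables G R T : 'M[C]_n.
Hypothesis gs : gaussian X a eta G.
Hypothesis defR : R = a_lin gam.
Hypothesis defT : T = mxsqrt G.

Let pG : pd G := gauss_pd gs.
Let TT : T * T = G. Proof. by rewrite defT; have [hG _] := pG; apply: mxsqrtK. Qed.
Let hT : T ^t* = T. Proof. by rewrite defT; have [] := mxsqrt_pd pG. Qed.

Lemma a_lin_delta j : a_lin (fun i => (i == j)%:R) = a j.
Proof.
rewrite /a_lin (bigD1 j) //= eqxx scale1r big1 ?addr0 // => i /negPf->.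
by rewrite scale0r.
Qed.

Lemma a_R j : a j * R + R * a j = (2 * gam j) *: (1 : 'M[C]_n).
Proof.
rewrite -[a j]a_lin_delta defR (a_lin_acomm cl); congr (_ * _ *: _).
by rewrite (bigD1 j) //= eqxx mul1r big1 ?addr0 // => i /negPf->; rewrite mul0r.
Qed.

Lemma R_invol : R * R = 1.
Proof.
have := a_lin_acomm cl gam gam; rewrite gam1 mulr1 -defR -mulr2n -scaler_nat.
by move/scalerI; apply; rewrite pnatr_eq0.
Qed.

Lemma R_herm : R ^t* = R.
Proof.
rewrite defR /a_lin ct_sum; apply: eq_bigr => i _.
by rewrite ctZ (cliffa_herm cl) conj_Creal.
Qed.

Lemma R_anti_a f : \sum_j gam j * f j = 0 -> R * a_lin f = - (a_lin f * R).
Proof.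
move=> e; have := a_lin_acomm cl gam f; rewrite -defR e mulr0 scale0r => /eqP.
by rewrite addr_eq0 => /eqP.
Qed.

Lemma R_anti_c f : R * c_lin f = - (c_lin f * R).
Proof. by have /eqP := ac_lin_acomm cl gam f; rewrite -defR addr_eq0 => /eqP. Qed.

Lemma G_comm_a f : G * a_lin f - a_lin f * G =
  G * c_lin (fun j => eta j * f j) + c_lin (fun j => eta j * f j) * G.
Proof.
rewrite !mulr_sumr !mulr_suml -sumrB -big_split; apply: eq_bigr => j _ /=.
rewrite !mxZr !mxZl -scalerBr (gauss_a gs) -scalerDr scalerA mulrC.
by [].
Qed.

Lemma G_comm_c f : G * c_lin f - c_lin f * G =
  G * a_lin (fun j => eta j * f j) + a_lin (fun j => eta j * f j) * G.
Proof.
rewrite !mulr_sumr !mulr_suml -sumrB -big_split; apply: eq_bigr => j _ /=.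
rewrite !mxZr !mxZl -scalerBr (gauss_c gs) -scalerDr scalerA mulrC.
by [].
Qed.

(** The sandwich identity turns T a_j T into sin theta_j / 2 {G, a_j}, and under
    the trace against R only the scalar {a_j, R} = 2 gamma_j survives. *)
Lemma tr_RTRT : \tr (R * T * R * T) = \sum_j gam j ^+ 2 * sqrtC (1 - eta j ^+ 2).
Proof.
rewrite -!mulrA {2}defR /a_lin mulr_suml !mulr_sumr.
rewrite raddf_sum /=; apply: eq_bigr => j _.
rewrite mxZl !mxZr mxtraceZ mulrA.
rewrite -!mulrA [T * (_ * _)]mulrA defT (sandwich pG (eta1 j) (gauss_a gs j) (gauss_c gs j)).
rewrite mxZr mxtraceZ mulrDr raddfD /=.
have -> : \tr (R * (G * a j)) + \tr (R * (a j * G)) = \tr (G * (a j * R + R * a j)).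
  by rewrite mulrDr raddfD /=; congr (_ + _); [rewrite trM mulrA|rewrite mulrA trM].
rewrite a_R mxZr mulr1 mxtraceZ (gauss_tr gs) mulr1.
by field.
Qed.

Variables E S F : 'M[C]_n.
Hypothesis defE : E = 2^-1 *: (G + R * G * R).
Hypothesis defS : S = mxsqrt E.
Hypothesis defF : F = mxsqrtV E.

Lemma E_pd : pd E.
Proof.
rewrite defE; apply: pdZ; first by rewrite invr_gt0 ltr0n.
apply: pdD => //; rewrite -[X in _ * G * X]R_herm; apply: pd_congr => //.
by have [] := mulmx1_unit R_invol.
Qed.

Let FS : F * S = 1. Proof. rewrite defF defS; exact: mxsqrtVl E_pd. Qed.
Let SF : S * F = 1. Proof. rewrite defF defS; exact: mxsqrtVr E_pd. Qed.
Let SS : S * S = E. Proof. by rewrite defS; have [hE _] := E_pd; apply: mxsqrtK. Qed.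

(** The pinched state E obeys the relations of G with eta compressed to the
    orthogonal complement of gamma: [E_comm_a] restricts f to the complement,
    and in [E_comm_c] the component w along gamma drops out. *)
Lemma E_comm_a f : \sum_j gam j * f j = 0 -> E * a_lin f - a_lin f * E =
  E * c_lin (fun j => eta j * f j) + c_lin (fun j => eta j * f j) * E.
Proof.
move=> gf; rewrite defE !mxZl !mxZr -scalerBr -scalerDr; congr (_ *: _).
rewrite !mulrDl !mulrDr opprD addrACA [RHS]addrACA G_comm_a; congr (_ + _).
by rewrite (conj_comm _ R_invol (R_anti_a gf)) (conj_acomm _ R_invol (R_anti_c _)) G_comm_a.
Qed.

Lemma E_comm_c f h w : (forall j, eta j * f j = h j + w * gam j) ->
  \sum_j gam j * h j = 0 -> E * c_lin f - c_lin f * E = E * a_lin h + a_lin h * E.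
Proof.
move=> fh gh; rewrite defE !mxZl !mxZr -scalerBr -scalerDr; congr (_ *: _).
rewrite !mulrDl !mulrDr opprD addrACA [RHS]addrACA.
rewrite (conj_comm _ R_invol (R_anti_c _)) (conj_acomm _ R_invol (R_anti_a gh)) G_comm_c.
have -> : a_lin (fun j => eta j * f j) = a_lin h + w *: R.
  rewrite defR /a_lin scaler_sumr -big_split; apply: eq_bigr => j _ /=.
  by rewrite fh scalerDl scalerA.
rewrite !(mulrDl, mulrDr) !(mxZl, mxZr) -!mulrA R_invol !mulrA R_invol mulr1 mul1r.
move: (G * _) (_ * G) (R * (G * a_lin h) * R) (R * (a_lin h * G) * R) (G * R) (R * G).
move=> *; apply/matrixP=> i j; rewrite !mxE; ring.
Qed.

(** The part of G that anticommutes with R is determined by E, because R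
    commutes with E while [G, R] = {G, c(D gamma)}. *)
Lemma E_acomm_C : let Cc := c_lin (fun j => eta j * gam j) in
  E * Cc + Cc * E = G * R - R * G.
Proof.
move=> Cc; rewrite defE mxZl mxZr -scalerDr mulrDl mulrDr addrACA.
rewrite (conj_acomm _ R_invol (R_anti_c _)) -G_comm_a -defR.
rewrite mulrBr mulrBl !mulrA R_invol mul1r -mulrA R_invol mulr1 opprB -mulr2n.
by rewrite -[X in _ *: X]scaler_nat scalerA mulVf ?scale1r // pnatr_eq0.
Qed.

(** T P T and P G P are A^* A and A A^* for A = P T, and (A^* A)^(1/2) equals
    A^* (A A^* )^(-1/2) A; here P G P = P E, with P commuting with E. *)
Lemma sqrt_compress (P : 'M[C]_n) : P ^t* = P -> P * P = P -> P * E = E * P ->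
  P * G * P = P * E -> mxsqrt (T * P * T) = T * (F * P) * T.
Proof.
move=> hP PP PE P_G_P.
have [hE _] := E_pd; have PF : F * P = P * F by rewrite defF; apply: mxfun_comm.
have inner : F * P * G * (F * P) = P.
  rewrite {2}PF !mulrA -(mulrA F P G) -(mulrA F (P * G)) P_G_P PE !mulrA.
  by rewrite -mulrA -PF !mulrA -SS !mulrA FS mul1r SF mul1r.
have pX : psd (T * (F * P) * T).
  have -> : T * (F * P) * T = (T * P) * F * (T * P) ^t*.
    by rewrite -!mulmxE ctM hT hP !mulmxE !mulrA -(mulrA T P) -PF -!mulrA (mulrA P P) PP.
  by apply: psd_congr; apply: pd_psd; rewrite defF; apply: mxsqrtV_pd E_pd.
rewrite -[RHS](mxsqrt_unique pX); congr mxsqrt.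
have -> : T * (F * P) * T *m (T * (F * P) * T) = T * (F * P * (T * T) * (F * P)) * T.
  by rewrite mulmxE !mulrA.
by rewrite TT inner.
Qed.

(* The signs e = 1 and e = - 1 give the two projections P and 1 - P. *)
Section Projection.
Variable e : C.
Hypothesis e1 : e * e = 1.
Hypothesis e_real : e \is Num.real.

Let P : 'M[C]_n := 2^-1 *: (1 + e *: R).

Lemma P_herm : P ^t* = P.
Proof.
rewrite /P ctZ ctD ctZ R_herm trmx1 map_mx1 !conj_Creal ?realV ?realn //.
Qed.

Lemma P_idem : P * P = P.
Proof.
rewrite /P !(mxZl, mxZr) !(mulrDl, mulrDr) !(mxZl, mxZr) R_invol !mul1r !mulr1.
rewrite [e *: (e *: _)]scalerA e1.
move: (1 : 'M[C]_n) (R) => x y; apply/matrixP=> i j; rewrite !mxE.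
by field.
Qed.

Lemma ER : E * R = R * E.
Proof.
rewrite defE mxZl mxZr mulrDl mulrDr.
rewrite -[R * G * R * R]mulrA R_invol mulr1 !mulrA R_invol mul1r.
by rewrite addrC.
Qed.

Lemma P_E : P * E = E * P.
Proof.
by rewrite /P mxZl mxZr mulrDl mulrDr mul1r mulr1 mxZl mxZr ER.
Qed.

Lemma P_G_P : P * G * P = P * E.
Proof.
rewrite /P defE !(mxZl, mxZr) !(mulrDl, mulrDr) !(mxZl, mxZr) !mul1r !mulr1.
rewrite !mulrA R_invol mul1r.
move: (G) (G * R) (R * G) (R * G * R) => x y z t; apply/matrixP=> i j; rewrite !mxE.
apply: (subr_sub_eq (congr1 (fun s => 4^-1 * s * t i j) e1)).
by field.
Qed.

Lemma sqrt_P : mxsqrt (T * P * T) = T * (F * P) * T.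
Proof. by apply: sqrt_compress; [exact: P_herm|exact: P_idem|exact: P_E|exact: P_G_P]. Qed.

End Projection.

Let P : 'M[C]_n := 2^-1 *: (1 + R).
Let P' : 'M[C]_n := 2^-1 *: (1 - R).

(* A spectral decomposition of eta compressed to the complement of gamma: (f m)
   and (g m) are paired singular vectors with singular value (lam m), and the
   last hypothesis expands D gamma in the f m.  The coefficients kap are those
   of the expansion already divided by sqrt (1 - lam ^ 2). *)
Variables (M : finType) (f g : M -> 'I_N -> C) (lam w kap : M -> C).
Hypothesis lam1 : forall m, -1 < lam m < 1.
Hypothesis Df : forall m j, eta j * f m j = lam m * g m j + w m * gam j.
Hypothesis Dg : forall m j, eta j * g m j = lam m * f m j.
Hypothesis gam_g : forall m, \sum_j gam j * g m j = 0.
Hypothesis Dgam : forall j, eta j * gam j =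
  \sum_m kap m * (sqrtC (1 - lam m ^+ 2) * f m j).

Lemma c_linZ k h : c_lin (fun j => k * h j) = k *: c_lin h.
Proof. by rewrite /c_lin scaler_sumr; apply: eq_bigr => j _; rewrite scalerA. Qed.

Lemma a_linZ k h : a_lin (fun j => k * h j) = k *: a_lin h.
Proof. by rewrite /a_lin scaler_sumr; apply: eq_bigr => j _; rewrite scalerA. Qed.

Lemma eq_c_lin h h' : h =1 h' -> c_lin h = c_lin h'.
Proof. by move=> e; apply: eq_bigr => j _; rewrite e. Qed.

Let ctil j := \sum_m kap m * f m j.

(** Every c(f_m) sandwiches through E^(1/2) with the factor
    sqrt (1 - lam_m ^ 2) / 2, which [kap] was chosen to absorb. *)
Lemma GR_comm : G * R - R * G = 2%:R *: (S * c_lin ctil * S).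
Proof.
rewrite -E_acomm_C (eq_c_lin Dgam).
have c_lin_sum (h : M -> 'I_N -> C) : 
      c_lin (fun j => \sum_m kap m * h m j) = \sum_m kap m *: c_lin (h m).
  rewrite /c_lin; under eq_bigr do rewrite scaler_suml.
  rewrite exchange_big; apply: eq_bigr => m _ /=.
  by rewrite scaler_sumr; apply: eq_bigr => j _; rewrite scalerA.
rewrite !c_lin_sum !mulr_sumr !mulr_suml -big_split scaler_sumr; apply: eq_bigr => m _ /=.
rewrite !(mxZl, mxZr) -scalerDr scalerA mulrC -scalerA; congr (_ *: _).
rewrite defS (sandwich (q := a_lin (g m)) E_pd (lam1 m)).
- rewrite scalerA mulrC divfK ?pnatr_eq0 // c_linZ.
  by rewrite mxZl mxZr scalerDr.
- rewrite (E_comm_c (h := fun j => lam m * g m j) (w := w m)) // ?a_linZ.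
    by rewrite mxZl mxZr scalerDr.
  under eq_bigr do rewrite mulrCA.
  by rewrite -mulr_sumr gam_g mulr0.
- by rewrite E_comm_a // (eq_c_lin (Dg m)) c_linZ mxZl mxZr scalerDr.
Qed.

Lemma tr_G_c h : \tr (G * c_lin h) = 0.
Proof.
rewrite mulr_sumr raddf_sum big1 // => j _ /=.
by rewrite mxZr mxtraceZ (gauss_tr_c gs) mulr0.
Qed.

(** Two-point function of the state: take the trace of [G, R] = {G, c(D gamma)}
    against c(h), where c(h) anticommutes with R and {c, c} is a scalar. *)
Lemma tr_G_c_R h : \tr (G * c_lin h * R) = \sum_j eta j * gam j * h j.
Proof.
have := congr1 (fun M => \tr (M * c_lin h)) (G_comm_a gam); rewrite -defR /=.
set Cc := c_lin (fun j => eta j * gam j) => e0.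
have eL : \tr ((G * R - R * G) * c_lin h) = - 2 * \tr (G * c_lin h * R).
  rewrite mulrBl raddfB /= -(mulrA G R) R_anti_c mulrN mulrA raddfN /=.
  by rewrite -(mulrA R G) [\tr (R * _)]trM; ring.
have eR : \tr ((G * Cc + Cc * G) * c_lin h) = - (2 * \sum_j eta j * gam j * h j).
  rewrite mulrDl raddfD /= -!mulrA [X in _ + X]trM -(mulrA G) -raddfD /= -mulrDr.
  by rewrite (c_lin_acomm cl) mxZr mulr1 mxtraceZ (gauss_tr gs) mulr1.
have two : - 2 != 0 :> C by rewrite oppr_eq0 pnatr_eq0.
by apply: (mulfI two); rewrite -eL e0 eR mulNr.
Qed.

(** The inverse roots meet P G P' = - [G, R] P' / 2 on both sides; by [GR_comm]
    what is left is linear in the c_j, and [tr_G_c_R] evaluates it. *)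
Lemma tr_sqrt_sqrt : 2 * \tr (mxsqrt (T * P * T) * mxsqrt (T * P' * T)) =
  \sum_m kap m * \sum_j eta j * gam j * f m j.
Proof.
have defP : P = 2^-1 *: (1 + 1 *: R) by rewrite scale1r.
have defP' : P' = 2^-1 *: (1 + (-1) *: R) by rewrite scaleN1r.
have r1 : (1 : C) \is Num.real by rewrite realE ler01.
have rN1 : (-1 : C) \is Num.real by rewrite rpredN.
have e1 : (1 : C) * 1 = 1 by rewrite mulr1.
have eN1 : (-1 : C) * -1 = 1 by rewrite mulrNN mulr1.
rewrite defP (sqrt_P e1 r1) defP' (sqrt_P eN1 rN1) -defP -defP'.
have [hE _] := E_pd.
have P'F : F * P' = P' * F.
  by rewrite defF; apply: mxfun_comm => //; rewrite defP'; apply/esym/P_E.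
have PGP' : P * G * P' = - 2^-1 *: ((G * R - R * G) * P').
  rewrite /P /P' !(mxZl, mxZr) !(mulrDl, mulrDr, mulrN, mulNr) !mul1r !mulr1.
  rewrite -[G * R * R]mulrA R_invol mulr1.
  move: (G) (G * R) (R * G) (R * G * R) => x y z t.
  by apply/matrixP=> i j; rewrite !mxE; field.
have key : F * P * G * F * P' = - (c_lin ctil * P').
  clear defP defP'; clearbody P P'.
  have -> : F * P * G * F * P' = F * (P * G * P') * F.
    by rewrite -[LHS]mulrA P'F !mulrA.
  rewrite PGP' GR_comm mxZr mxZl scaleNr mxZl !mxZr mxZl scalerA.
  rewrite mulVf ?pnatr_eq0 // scale1r; congr (- _).
  by rewrite !mulrA FS mul1r -!mulrA -P'F (mulrA S) SF mul1r.
have -> : \tr (T * (F * P) * T * (T * (F * P') * T)) =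
    \tr (F * P * G * F * P' * G).
  by rewrite -TT -!mulrA trM !mulrA.
have -> : \tr (F * P * G * F * P' * G) = 2^-1 * \sum_j eta j * gam j * ctil j.
  rewrite key mulNr raddfN /= /P' mxZr mxZl mxtraceZ mulrBr mulr1 mulrBl raddfB /=.
  rewrite trM tr_G_c sub0r mulrN opprK; congr (_ * _).
  by rewrite trM mulrA tr_G_c_R.
rewrite mulrA divff ?pnatr_eq0 // mul1r /ctil.
under eq_bigr do rewrite mulr_sumr.
rewrite exchange_big; apply: eq_bigr => m _ /=; rewrite mulr_sumr.
by apply: eq_bigr => j _; rewrite mulrCA.
Qed.

(** K + L = G and K - L = T R T, so the inverse roots of G cancel two of the
    four factors T in the second term of J. *)
Lemma J_split : J (T * P * T) (T * P' * T) =
  \tr (mxsqrt (T * P * T) * mxsqrt (T * P' * T)) + 2^-1 * \tr (R * T * R * T).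
Proof.
have half (x : 'M[C]_n) : 2^-1 *: x + 2^-1 *: x = x.
  rewrite -scalerDl (_ : 2^-1 + 2^-1 = 1 :> C) ?scale1r //; by field.
have PP' : P + P' = 1.
  rewrite /P /P' -scalerDr addrACA subrr addr0 scalerDr; exact: half.
have PmP' : P - P' = R.
  by rewrite /P /P' -scalerBr opprB addrC addrA subrK scalerDr half.
rewrite /J !mulmxE -mulrDl -mulrDr PP' mulr1 TT -mulrBl -mulrBr PmP'.
congr (_ + _ * _); set V := mxsqrtV G.
have VT : V * T = 1 by rewrite defT; apply: mxsqrtVl.
have TV : T * V = 1 by rewrite defT; apply: mxsqrtVr.
clearbody V; by rewrite !mulrA VT mul1r -[_ * T * V]mulrA TV mulr1.
Qed.

End Measured.

(** * The spin chain as a Clifford system *)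

Section Qubits.
Variable C : numClosedFieldType.
Implicit Types (N : nat) (A B : nat -> 'M[C]_2).

Lemma tensorM N A B : tensor N A * tensor N B = tensor N (fun i => A i * B i).
Proof.
elim: N => [|N IHN] /=; first by rewrite mul1r.
by rewrite -IHN -!mulmxE tensmx_mul.
Qed.

Lemma eq_tensor N A B : (forall i, (i < N)%N -> A i = B i) ->
  tensor N A = tensor N B.
Proof.
elim: N => [//|N IHN] e /=; rewrite (e N) // IHN // => i iN.
by apply: e; apply: ltnW.
Qed.

Lemma tensor1 N : tensor N (fun=> 1%:M : 'M[C]_2) = 1.
Proof.
elim: N => [//|N /= ->]; apply/matrixP=> i j.
case: (mxtens_indexP i) => i0 i1; case: (mxtens_indexP j) => j0 j1.
rewrite tensmxE !mxE -natrM mulnb; congr (_%:R); congr nat_of_bool.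
apply/andP/eqP => [[/eqP-> /eqP->] //|].
by move=> /(can_inj (@mxtens_indexK _ _)) [-> ->].
Qed.

Lemma tensor_ct N A : (tensor N A) ^t* = tensor N (fun i => (A i) ^t*).
Proof.
elim: N => [|N IHN] /=; first by rewrite trmx1 map_mx1.
by rewrite -IHN; apply/matrixP=> i j; rewrite !mxE rmorphM.
Qed.

Lemma tensor_comm N A B : (forall i, (i < N)%N -> A i * B i = B i * A i) ->
  tensor N A * tensor N B = tensor N B * tensor N A.
Proof. by move=> e; rewrite !tensorM; apply: eq_tensor. Qed.

Lemma tensor_oppr N j A B : (j < N)%N -> A j = - B j ->
  (forall i, (i < N)%N -> i != j -> A i = B i) -> tensor N A = - tensor N B.
Proof.
elim: N => [//|N IHN]; rewrite ltnS leq_eqVlt => /predU1P[->|jN] ej e /=.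
  rewrite ej (@eq_tensor N A B) => [|i iN].
    by apply/matrixP=> i k; rewrite !mxE mulrN.
  by apply: e; [apply: ltnW|rewrite ltn_eqF].
rewrite IHN // => [|i iN]; last by apply: e; apply: ltnW.
by rewrite (e N) ?gtn_eqF //; apply/matrixP=> i k; rewrite !mxE mulNr.
Qed.

(** Tensor products that commute at all sites but one, where they anticommute,
    anticommute: all relations of the chain are checked site by site. *)
Lemma tensor_anti N j A B : (j < N)%N -> A j * B j = - (B j * A j) ->
  (forall i, (i < N)%N -> i != j -> A i * B i = B i * A i) ->
  tensor N A * tensor N B = - (tensor N B * tensor N A).
Proof. by move=> jN ej e; rewrite !tensorM; apply: tensor_oppr ej e. Qed.

Let x : 'M[C]_2 := pauliX C.
Let z : 'M[C]_2 := pauliZ C.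

Lemma pauliXX : x * x = 1.
Proof.
apply/matrixP=> i j; rewrite !mxE !big_ord_recl big_ord0 !mxE.
by case: (unliftP 0 i) => [i'|] ->; case: (unliftP 0 j) => [j'|] ->;
  rewrite ?ord1 /= ?(mulr0, mulr1, mul0r, addr0, add0r).
Qed.

Lemma pauliZZ : z * z = 1.
Proof.
apply/matrixP=> i j; rewrite !mxE !big_ord_recl big_ord0 !mxE.
by case: (unliftP 0 i) => [i'|] ->; case: (unliftP 0 j) => [j'|] ->;
  rewrite ?ord1 /= ?(mulr0, mulr1, mul0r, addr0, add0r, expr0, expr1, mulrNN).
Qed.

Lemma pauliZX_anti : z * x = - (x * z).
Proof.
apply/matrixP=> i j; rewrite !mxE !big_ord_recl !big_ord0 !mxE.
by case: (unliftP 0 i) => [i'|] ->; case: (unliftP 0 j) => [j'|] ->;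
  rewrite ?ord1 /= ?(mulr0, mulr1, mul0r, mul1r, addr0, add0r, expr0, expr1, opprK, oppr0).
Qed.

Lemma pauliX_ct : x ^t* = x.
Proof.
by apply/matrixP=> i j; rewrite !mxE rmorph_nat eq_sym.
Qed.

Lemma pauliZ_ct : z ^t* = z.
Proof.
apply/matrixP=> i j; rewrite !mxE rmorphM rmorph_nat rmorphXn rmorphN rmorph1 /=.
by rewrite eq_sym; case: eqVneq => [->|]; rewrite ?mulr0.
Qed.

Lemma tensor_prod N (I : Type) (r : seq I) (P : pred I) (B : I -> nat -> 'M[C]_2) :
  \prod_(i <- r | P i) tensor N (B i) =
  tensor N (fun k => \prod_(i <- r | P i) B i k).
Proof.
elim: r => [|i r IHr].
  by rewrite big_nil -(tensor1 N); apply: eq_tensor => k _; rewrite big_nil.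
rewrite big_cons; case Pi: (P i); last first.
  by rewrite IHr; apply: eq_tensor => k _; rewrite big_cons Pi.
by rewrite IHr tensorM; apply: eq_tensor => k _; rewrite big_cons Pi.
Qed.

(** The k-th tensor factor of a_j: a Jordan-Wigner string. *)
Definition majorana j k := if (k < j)%N then x else if k == j then z else 1.

Lemma a_tensor N (j : 'I_N) : a_ C j = tensor N (majorana j).
Proof.
rewrite /a_ /X_ /Z_ /site tensor_prod mulmxE tensorM; apply: eq_tensor => k kN.
under eq_bigr => i _ do rewrite -[k == i]/(Ordinal kN == i).
have -> : \prod_(i < N | (i < j)%N) (if Ordinal kN == i then pauliX C else 1%:M) =
    if (k < j)%N then x else 1.
  rewrite -big_mkcondr /=; case: ifP => kj.
    by rewrite (big_pred1 (Ordinal kN)) // => i /=; rewrite eq_sym;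
      case: eqP => [->|]; rewrite ?kj ?andbF.
  by rewrite big_pred0 // => i; case: eqP => [<-|]; rewrite ?andbF // andbT.
rewrite /majorana; case: ltngtP => // _; by rewrite ?mul1r ?mulr1.
Qed.

Lemma qubit_clifford N : clifford (@X_ C N) (@a_ C N).
Proof.
split.
- move=> i j; apply: tensor_comm => k _.
  by do 2![case: eqP => _]; rewrite ?mul1r ?mulr1.
- move=> i; rewrite tensorM -[RHS](tensor1 N); apply: eq_tensor => k _.
  by case: eqP => _; rewrite ?pauliXX ?mulr1.
- move=> i; rewrite tensor_ct; apply: eq_tensor => k _.
  by case: eqP => _; rewrite ?pauliX_ct // trmx1 map_mx1.
- move=> i; rewrite a_tensor tensorM -[RHS](tensor1 N); apply: eq_tensor => k _.
  by rewrite /majorana; case: ltngtP => _; rewrite ?pauliXX ?pauliZZ ?mulr1.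
- move=> i; rewrite a_tensor tensor_ct; apply: eq_tensor => k _.
  by rewrite /majorana; case: ltngtP => _; rewrite ?pauliX_ct ?pauliZ_ct // trmx1 map_mx1.
- have lt (i j : 'I_N) : (i < j)%N -> a_ C i * a_ C j = - (a_ C j * a_ C i).
    move=> ij; rewrite !a_tensor; apply: (@tensor_anti _ i) => //.
      by rewrite /majorana ltnn eqxx ij pauliZX_anti.
    move=> k _ ki; rewrite /majorana; case: (ltngtP k i) ki => //= [ki _|ik _].
      by rewrite (ltn_trans ki ij).
    by rewrite mulr1 mul1r.
  move=> i j; rewrite neq_ltn => /orP[/lt//|/lt ->].
  by rewrite opprK.
- move=> i; rewrite a_tensor; apply: (@tensor_anti _ i) => //.
    by rewrite /majorana ltnn eqxx pauliZX_anti.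
  by move=> k _ /negPf ->; rewrite mulr1 mul1r.
- move=> i j ij; rewrite a_tensor; apply: tensor_comm => k _.
  case: eqP => [->|_]; last by rewrite mulr1 mul1r.
  rewrite /majorana; case: ltngtP => //; first by rewrite mul1r mulr1.
  by move/val_inj => e; rewrite e eqxx in ij.
Qed.

Lemma qdimE N : qdim N = (2 ^ N)%N.
Proof. by elim: N => //= N ->; rewrite expnSr. Qed.

End Qubits.

(** * Trigonometric sums and eigenvectors at the Chebyshev nodes *)

Section Trig.
Variable R : realType.
Implicit Types (x y : R) (n k : nat).

Lemma sum_cos x y n : 2 * sin (x / 2) * \sum_(j < n) cos (y + j%:R * x) =
  sin (y + n%:R * x - x / 2) - sin (y - x / 2).
Proof.
elim: n => [|n IHn]; first by rewrite big_ord0 mulr0 mul0r addr0 subrr.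
rewrite big_ord_recr /= mulrDr IHn; set a := y + n%:R * x.
have -> : y + n.+1%:R * x - x / 2 = a + x / 2 by rewrite /a -natr1; field.
by rewrite (sinD a (x / 2)) (sinB a); ring.
Qed.

Lemma sum_sin x y n : 2 * sin (x / 2) * \sum_(j < n) sin (y + j%:R * x) =
  cos (y - x / 2) - cos (y + n%:R * x - x / 2).
Proof.
elim: n => [|n IHn]; first by rewrite big_ord0 mulr0 mul0r addr0 subrr.
rewrite big_ord_recr /= mulrDr IHn; set a := y + n%:R * x.
have -> : y + n.+1%:R * x - x / 2 = a + x / 2 by rewrite /a -natr1; field.
by rewrite (cosD a (x / 2)) (cosB a); ring.
Qed.

Lemma sin_natpi k : sin (k%:R * pi) = 0 :> R.
Proof.
elim: k => [|k IHk]; first by rewrite mul0r sin0.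
by rewrite -natr1 mulrDl mul1r sinDpi IHk oppr0.
Qed.

Lemma cos_mul x y : cos x * cos y = (cos (x - y) + cos (x + y)) / 2.
Proof. by rewrite cosB cosD; field. Qed.

Lemma sin_mul x y : sin x * sin y = (cos (x - y) - cos (x + y)) / 2.
Proof. by rewrite cosB cosD; field. Qed.

Variable K : nat.
Let N := K.+1.
Let Nn0 : N%:R != 0 :> R. Proof. by rewrite pnatr_eq0. Qed.
Definition phi (m : nat) : R := m%:R * pi / N%:R.

Lemma sin_phi_gt0 m : (0 < m < N)%N -> 0 < sin (phi m).
Proof.
case/andP=> m0 mN; apply: sin_gt0_pi; apply/andP; split.
  by rewrite /phi !(mulr_gt0, invr_gt0, pi_gt0, ltr0n).
by rewrite /phi ltr_pdivrMr // mulrC ltr_pM2l ?pi_gt0 // ltr_nat.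
Qed.

Lemma sum_cos_theta k : (0 < k < N.*2)%N -> \sum_(j < N) cos (k%:R * theta R j) = 0.
Proof.
case/andP=> k0 kN; pose x : R := k%:R * pi / N%:R.
have s0 : 0 < sin (x / 2).
  apply: sin_gt0_pi; apply/andP; split.
    by rewrite /x !(mulr_gt0, invr_gt0, pi_gt0, ltr0n).
  rewrite /x ltr_pdivrMr ?ltr0n // ltr_pdivrMr ?ltr0n // mulrC -mulrA ltr_pM2l ?pi_gt0 //.
  by rewrite -natrM ltr_nat mul2n.
have := sum_cos x (x / 2) N; rewrite subrr sin0 subr0.
have -> : x / 2 + N%:R * x - x / 2 = k%:R * pi by rewrite /x; field.
rewrite sin_natpi => /eqP; rewrite -mulrA !mulf_eq0 pnatr_eq0 /= gt_eqF //= => /eqP {2}<-.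
by apply: eq_bigr => j _; congr cos; rewrite /x /theta; field.
Qed.

Lemma sum_cos_phi t : (0 < t < N)%N -> \sum_(m < N) cos ((2 * t)%:R * phi m) = 0.
Proof.
move=> tN; pose x : R := (2 * t)%:R * pi / N%:R.
have x2 : x / 2 = phi t by rewrite /x /phi natrM; field.
have s0 := sin_phi_gt0 tN.
have := sum_cos x 0 N; rewrite !sub0r sinN opprK x2.
have -> : 0 + N%:R * x - phi t = - phi t + t%:R * pi *+ 2.
  by rewrite /x /phi natrM; field.
have -> : sin (- phi t + t%:R * pi *+ 2) = - sin (phi t).
  rewrite sinD -mulr_natl mulrA -natrM sin_natpi mulr0 addr0.
  have -> : cos ((2 * t)%:R * pi) = 1 :> R.
    by elim: (t) => [|t' IH]; rewrite ?muln0 ?mul0r ?cos0 // mulnS natrD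
      mulrDl addrC [2%:R * pi]mulr_natl cosD2pi.
  by rewrite mulr1 sinN.
rewrite addNr => /eqP; rewrite -mulrA !mulf_eq0 pnatr_eq0 /= gt_eqF //= => /eqP {2}<-.
by apply: eq_bigr => j _; congr cos; rewrite /x /phi; field.
Qed.

(** With p = m pi / N and t = theta_j, these are the vectors f_m (b = true) and
    g_m (b = false): the sine eigenvectors of a path expanded in discrete
    cosines, split by the parity of k because multiplication by cos t exchanges
    the parities. *)
Definition mode (b : bool) (p t : R) n : R :=
  \sum_(0 <= k < n | odd k == b) sin (k%:R * p) * cos (k%:R * t).

Lemma mode_recr b p t n : mode b p t n.+1 = mode b p t n +
  (if odd n == b then sin (n%:R * p) * cos (n%:R * t) else 0).
Proof. by rewrite /mode big_mkcond big_nat_recr //= -big_mkcond. Qed.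

(** Both products cos t cos (k t) and cos p sin (k p) split into neighbours, and
    the difference telescopes along the bonds (k, k + 1): only the bond to
    k = - 1 and the last bond contribute. *)
Lemma mode_shift b p t n : 2 * (cos t * mode b p t n.+1 - cos p * mode (~~ b) p t n.+1) =
  b%:R * sin p + (if odd n == b then sin (n%:R * p) * cos (n.+1%:R * t)
                  else - (sin (n.+1%:R * p) * cos (n%:R * t))).
Proof.
elim: n => [|n IHn].
  rewrite /mode !(big_mkcond (fun k => odd k == _)) !big_nat1 /= mul0r sin0 !mul0r cos0 mul1r mulr1.
  by case: b; rewrite /= ?mulr0 ?subrr ?mulr0 ?mul1r ?mul0r ?addrN ?addr0.
rewrite mode_recr (mode_recr (~~ b)) [cos t * _]mulrDr [cos p * _]mulrDr opprD addrACA mulrDr IHn.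
rewrite -addrA; congr (_ + _); rewrite /= -[n.+2%:R]natr1.
have -> : n%:R = n.+1%:R - 1 :> R by rewrite -natr1 addrK.
set s := n.+1%:R; rewrite !(mulrDl _ _ p, mulrDl _ _ t) !mulN1r !mul1r.
rewrite !(sinD (s * p), cosD (s * t), sinN, cosN).
by case: (odd n); clear IHn; case: b => /=; ring.
Qed.

Lemma cosN_theta (j : 'I_N) : cos (N%:R * theta R j) = 0.
Proof.
have -> : N%:R * theta R j = j%:R * pi + pi / 2 by rewrite /theta; field.
by rewrite cosD sin_natpi cos_pihalf mulr0 mul0r subrr.
Qed.

Lemma sinN_phi m : sin (N%:R * phi m) = 0.
Proof. by rewrite -[RHS](sin_natpi m); congr sin; rewrite /phi; field. Qed.

(** At p = m pi / N and t = theta_j both sin (N p) and cos (N t) vanish, so the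
    last bond disappears; the remaining boundary term does not depend on j and
    is a multiple of gamma. *)
Lemma mode_eigen b m (j : 'I_N) : cos (theta R j) * mode b (phi m) (theta R j) N =
  cos (phi m) * mode (~~ b) (phi m) (theta R j) N + b%:R * sin (phi m) / 2.
Proof.
have := mode_shift b (phi m) (theta R j) K.
rewrite cosN_theta sinN_phi mulr0 mul0r oppr0 if_same addr0 => e.
have -> : b%:R * sin (phi m) / 2 =
    cos (theta R j) * mode b (phi m) (theta R j) N -
    cos (phi m) * mode (~~ b) (phi m) (theta R j) N.
  by rewrite -e mulrC mulKf ?pnatr_eq0.
by rewrite addrC subrK.
Qed.

Lemma sum_mode_even m : \sum_(j < N) mode false (phi m) (theta R j) N = 0.
Proof.
rewrite /mode exchange_big /= big_nat_cond big1 // => k /andP[/andP[_ kN] ok].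
rewrite -mulr_sumr; case: k kN ok => [|k] kN ok; first by rewrite mul0r sin0 mul0r.
by rewrite sum_cos_theta ?mulr0 // (leq_trans kN) // -addnn leq_addr.
Qed.

Lemma sum_sin_mode (j : 'I_N) : (1 < N)%N ->
  \sum_(m < N) sin (phi m) * mode true (phi m) (theta R j) N = N%:R / 2 * cos (theta R j).
Proof.
move=> N1; rewrite /mode; under eq_bigr do rewrite mulr_sumr.
rewrite exchange_big /=.
have e k : (k < N)%N -> odd k ->
    \sum_(m < N) sin (phi m) * (sin (k%:R * phi m) * cos (k%:R * theta R j)) =
    if k == 1%N then N%:R / 2 * cos (theta R j) else 0.
  move=> kN ok; have ek : k = (2 * k./2).+1 by rewrite mul2n -[LHS]odd_double_half ok.
  under eq_bigr => m _.
    rewrite mulrA sin_mul (_ : phi m - _ = - ((2 * k./2)%:R * phi m)); last first.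
      by rewrite {1}ek -natr1; ring.
    rewrite cosN (_ : phi m + _ = (2 * (k./2).+1)%:R * phi m); last first.
      by rewrite {1}ek -natr1 mulnS natrD; ring.
    over.
  have kK : (k <= K)%N by [].
  rewrite -!mulr_suml sumrB (@sum_cos_phi (k./2).+1) ?subr0; last by rewrite /N; lia.
  case: eqP => k1; last by rewrite sum_cos_phi ?mul0r // /N; lia.
  rewrite k1 /= mul1r; congr (_ / _ * _).
  under eq_bigr do rewrite muln0 mul0r cos0.
  by rewrite sumr_const card_ord.
rewrite big_mkcond; under eq_big_nat => k /andP[_ kN].
  rewrite (_ : (if _ then _ else _) = if k == 1%N then N%:R / 2 * cos (theta R j) else 0); last first.
    case: eqP => ok; first exact: e.
    by case: eqP => // k1; rewrite k1 in ok.
  over.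
rewrite -big_mkcond big_nat1_eq /=; by rewrite N1.
Qed.

Lemma sum_cos_mode m : (1 < N)%N ->
  \sum_(j < N) cos (theta R j) * mode true (phi m) (theta R j) N = N%:R / 2 * sin (phi m).
Proof.
move=> N1; rewrite /mode; under eq_bigr do rewrite mulr_sumr.
rewrite exchange_big /=.
have e k : (k < N)%N -> odd k ->
    \sum_(j < N) cos (theta R j) * (sin (k%:R * phi m) * cos (k%:R * theta R j)) =
    if k == 1%N then N%:R / 2 * sin (phi m) else 0.
  move=> kN ok; have ek : k = k.-1.+1 by case: (k) ok.
  under eq_bigr => j _.
    rewrite mulrCA cos_mul (_ : theta R j - _ = - (k.-1%:R * theta R j)); last first.
      by rewrite {1}ek -natr1; ring.
    rewrite cosN (_ : theta R j + _ = k.+1%:R * theta R j); last by rewrite -natr1; ring.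
    over.
  have kK : (k <= K)%N by [].
  rewrite -mulr_sumr -mulr_suml big_split /= (@sum_cos_theta k.+1) ?addr0; last by rewrite /N; lia.
  case: eqP => k1; last by rewrite sum_cos_theta ?mul0r ?mulr0 // /N; lia.
  rewrite k1 /= mul1r mulrC; congr (_ / _ * _).
  under eq_bigr do rewrite mul0r cos0.
  by rewrite sumr_const card_ord.
rewrite big_mkcond; under eq_big_nat => k /andP[_ kN].
  rewrite (_ : (if _ then _ else _) = if k == 1%N then N%:R / 2 * sin (phi m) else 0); last first.
    case: eqP => ok; first exact: e.
    by case: eqP => // k1; rewrite k1 in ok.
  over.
rewrite -big_mkcond big_nat1_eq /=; by rewrite N1.
Qed.

Lemma sin_pi2N_gt0 : 0 < sin (pi / (2 * N%:R)) :> R.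
Proof.
apply: sin_gt0_pi; apply/andP; split; first by rewrite divr_gt0 ?pi_gt0 ?mulr_gt0.
rewrite ltr_pdivrMr ?mulr_gt0 // ltr_pMr ?pi_gt0 // -natrM ltr1n.
by rewrite mul2n -addnn; lia.
Qed.

Lemma sum_sin_phi :
  \sum_(m < N) sin (phi m) = cos (pi / (2 * N%:R)) / sin (pi / (2 * N%:R)).
Proof.
have s0 := sin_pi2N_gt0; set p : R := pi / (2 * N%:R) in s0 *.
have := sum_sin (pi / N%:R) 0 N; rewrite !sub0r cosN.
have -> : pi / N%:R / 2 = p by rewrite /p; field.
have -> : 0 + N%:R * (pi / N%:R) - p = - p + pi by field.
rewrite cosDpi cosN opprK -mulr2n -(mulr_natl (cos p)) -mulrA.
have two : (2 : R) != 0 by rewrite pnatr_eq0.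
move/(mulfI two) => <-; rewrite mulrC mulKf ?gt_eqF //.
by apply: eq_bigr => m _; rewrite add0r /phi mulrA.
Qed.

Lemma sum_sin_theta : \sum_(j < N) sin (theta R j) = (sin (pi / (2 * N%:R)))^-1.
Proof.
have s0 := sin_pi2N_gt0; set p : R := pi / (2 * N%:R) in s0 *.
have := sum_sin (pi / N%:R) p N.
have -> : pi / N%:R / 2 = p by rewrite /p; field.
have -> : p + N%:R * (pi / N%:R) - p = pi by field.
rewrite subrr cos0 cospi opprK -mulrA => e.
apply: (mulfI (negbT (gt_eqF s0))); rewrite divff ?gt_eqF //.
have two : (2 : R) != 0 by rewrite pnatr_eq0.
apply: (mulfI two); rewrite mulr1; apply: etrans e; congr (_ * (_ * _)).
by apply: eq_bigr => j _; congr sin; rewrite /theta /p; field.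
Qed.
End Trig.

(** * Closed forms for the chain *)

Local Open Scope complex_scope.

Section Chain.
Variable R : realType.
Implicit Types (x : R).

Lemma itv_cosC x : 0 < sin x -> -1 < (cos x)%:C < 1.
Proof.
move=> s0; have c2 : cos x ^+ 2 < 1.
  by rewrite -(cos2Dsin2 x) ltrDl exprn_gt0.
rewrite -[-1](rmorphN1 (real_complex R)) -[X in _ < _ < X](rmorph1 (real_complex R)) !ltcR.
by rewrite -ltr_norml -(@expr_lt1 _ 2) // ?real_normK ?num_real.
Qed.

Lemma sqrtC_sinC x : 0 <= sin x -> sqrtC (1 - (cos x)%:C ^+ 2) = (sin x)%:C.
Proof.
move=> s0; have -> : 1 - (cos x)%:C ^+ 2 = (sin x)%:C ^+ 2.
  by rewrite -!rmorphXn -[1](rmorph1 (real_complex R)) -rmorphB /= sin2cos2.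
by rewrite sqrCK // lecR.
Qed.

Variable K : nat.
Let N := K.+1.

Let X := @X_ R[i] N.
Let a := @a_ R[i] N.
Let et (j : 'I_N) : R[i] := (eta R j)%:C.
Let ga (j : 'I_N) : R[i] := (gamma R j)%:C.
Let cl : clifford X a := qubit_clifford _ N.

Lemma theta_sin_gt0 (j : 'I_N) : 0 < sin (theta R j).
Proof.
apply: sin_gt0_pi; rewrite /theta; apply/andP; split.
  by rewrite !mulr_gt0 ?invr_gt0 ?pi_gt0 ?ltr0n // ltr_wpDl ?invr_gt0.
rewrite ltr_pdivrMr ?ltr0n // mulrC ltr_pM2l ?pi_gt0 //.
have : (j.+1%:R : R) <= N%:R by rewrite ler_nat.
by rewrite -natr1; apply: lt_le_trans; rewrite ltrD2l invf_lt1 ?ltr1n.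
Qed.

Let et1 j : -1 < et j < 1. Proof. exact/itv_cosC/theta_sin_gt0. Qed.

Let ga_real j : ga j \is Num.real.
Proof. by apply/complex_realP; exists (gamma R j). Qed.

Let ga1 : \sum_j ga j * ga j = 1.
Proof.
rewrite /ga; under eq_bigr do rewrite -rmorphM -expr2 /gamma exprVn sqr_sqrtr //.
rewrite sumr_const card_ord -rmorphMn /= -mulr_natl divff ?pnatr_eq0 //.
Qed.

Lemma G_prodG : G_ R N = prodG X et.
Proof. by rewrite /prodG; congr (_^-1 *: _); rewrite qdimE natrX. Qed.

Let gs : gaussian X a et (G_ R N).
Proof. by rewrite G_prodG; apply: prodG_gaussian => //; rewrite qdimE expn_gt0. Qed.

Lemma P_compl : 1%:M - P_ R N = 2^-1 *: (1%:M - R_ R N).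
Proof.
rewrite /P_; move: (1%:M) (R_ R N) => x y.
by apply/matrixP=> i j; rewrite !mxE; field.
Qed.

Lemma v_csc : v_ R N = (N%:R^-1 * csc (pi / (2 * N%:R)))%:C.
Proof.
rewrite /v_ !mulmxE (tr_RTRT cl et1 gs (erefl _) (erefl _)).
under eq_bigr => j _.
  rewrite /ga -rmorphXn /= /gamma exprVn sqr_sqrtr // sqrtC_sinC ?ltW ?theta_sin_gt0 // -rmorphM.
  over.
by rewrite -rmorph_sum -mulr_sumr /csc -(sum_sin_theta R K).
Qed.

Hypothesis K0 : (0 < K)%N.

(* The index m = 0 is left out: its eigenvalue cos 0 = 1 lies outside the range
   of the sandwich identity, and its vector is zero. *)
Let f (m : 'I_K) (j : 'I_N) : R[i] := (mode true (phi R K m.+1) (theta R j) N)%:C.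
Let g (m : 'I_K) (j : 'I_N) : R[i] := (mode false (phi R K m.+1) (theta R j) N)%:C.
Let lam (m : 'I_K) : R[i] := (cos (phi R K m.+1))%:C.
(* The factor sqrt N undoes the normalization of gamma. *)
Let w (m : 'I_K) : R[i] := (Num.sqrt N%:R * (sin (phi R K m.+1) / 2))%:C.
(* N / 2 is the squared norm of a discrete sine or cosine; the further root of
   N comes from gamma. *)
Let k0 : R := 2 / (N%:R * Num.sqrt N%:R).
Let kap (m : 'I_K) : R[i] := k0%:C.

Let sqrtN0 : Num.sqrt N%:R != 0 :> R.
Proof. by rewrite gt_eqF // sqrtr_gt0. Qed.

Let s0 (m : 'I_K) : 0 < sin (phi R K m.+1).
Proof. by apply: sin_phi_gt0; exact: ltn_ord m. Qed.

Let Df m j : et j * f m j = lam m * g m j + w m * ga j.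
Proof.
rewrite /et /f /lam /g /w /ga -!rmorphM -rmorphD; congr (_%:C).
rewrite /eta /gamma [LHS]mode_eigen mul1r; congr (_ + _).
by rewrite mulrAC divff // mul1r.
Qed.

Let Dg m j : et j * g m j = lam m * f m j.
Proof.
rewrite /et /f /lam /g -!rmorphM; congr (_%:C).
by rewrite /eta [LHS]mode_eigen !mul0r addr0.
Qed.

Let ga_g m : \sum_j ga j * g m j = 0.
Proof.
rewrite /ga /gamma -mulr_sumr -rmorph_sum sum_mode_even.
by rewrite rmorph0 mulr0.
Qed.

Lemma sum_from1 (F : nat -> R) : F 0%N = 0 -> \sum_(m < N) F m = \sum_(m < K) F m.+1.
Proof. by move=> F0; rewrite big_ord_recl F0 add0r. Qed.

Let N1 : (1 < N)%N. Proof. by []. Qed.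

Let Dga j : et j * ga j = \sum_m kap m * (sqrtC (1 - lam m ^+ 2) * f m j).
Proof.
rewrite /kap -mulr_sumr; under eq_bigr do rewrite sqrtC_sinC ?ltW // -rmorphM.
rewrite -rmorph_sum -!rmorphM; congr (_%:C).
have := sum_sin_mode R j N1.
rewrite (@sum_from1 (fun m => sin (phi R K m) * mode true (phi R K m) (theta R j) N)) => [->|]; last first.
  by rewrite /phi mul0r mul0r sin0 mul0r.
rewrite /gamma /k0 -[eta R j]/(cos (theta R j)) -/N.
move: (cos _) => c; field.
by rewrite sqrtN0 pnatr_eq0.
Qed.

Lemma u_cot : u_ R N = (N%:R^-1 * cot (pi / (2 * N%:R)))%:C.
Proof.
rewrite /u_ /K_ /L_ P_compl /P_ !mulmxE.
rewrite (tr_sqrt_sqrt cl ga_real ga1 gs (erefl _) (erefl _) (erefl _) (erefl _) (erefl _)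
  (fun m => itv_cosC (s0 m)) Df Dg ga_g Dga).
transitivity (\sum_(m < K) (N%:R^-1 * sin (phi R K m.+1))%:C).
  apply: eq_bigr => m _; rewrite /kap.
  under eq_bigr do rewrite -!rmorphM.
  rewrite -rmorph_sum -rmorphM; congr (_%:C).
  under eq_bigr do rewrite mulrAC.
  rewrite -mulr_suml (sum_cos_mode R (m.+1) N1).
  have sq : Num.sqrt N%:R * Num.sqrt N%:R = N%:R :> R by rewrite -expr2 sqr_sqrtr.
  rewrite /gamma /k0 -/N; move: (sin _) => c.
  have nN : N%:R != 0 :> R by rewrite pnatr_eq0.
  move: sq sqrtN0 nN; move: (Num.sqrt _) => s; move: (N%:R) => n <- s_n0 _.
  by field.
rewrite -rmorph_sum -mulr_sumr /cot -(sum_sin_phi R K) (@sum_from1 (fun m => sin (phi R K m))) //.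
by rewrite /phi !mul0r sin0.
Qed.

Lemma J_cot : J (K_ R N) (L_ R N) = ((2 * N%:R)^-1 * cot (pi / (4 * N%:R)))%:C.
Proof.
have -> : J (K_ R N) (L_ R N) = 2^-1 * u_ R N + 2^-1 * v_ R N.
  rewrite /u_ /v_ /K_ /L_ P_compl /P_ !mulmxE.
  rewrite (J_split (R_ R N) gs (erefl _)).
  by congr (_ + _); rewrite mulKf ?pnatr_eq0.
rewrite u_cot v_csc -mulrDr -rmorphD -(rmorph_nat (real_complex R)) -fmorphV -rmorphM.
congr (_%:C); rewrite -mulrDr mulrA -invfM; congr (_ * _).
have s1 := sin_pi2N_gt0 R K; rewrite /cot /csc.
have e2 : pi / (2 * N%:R) = (pi / (4 * N%:R)) *+ 2 :> R.
  by rewrite -[RHS]mulr_natl; field; rewrite pnatr_eq0.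
move: s1; rewrite e2; set p : R := pi / (4 * N%:R).
rewrite sin_mulr2n cos_mulr2n => s1.
have sp : sin p != 0 by apply: contraTneq s1 => ->; rewrite mulr0 mul0rn ltxx.
have cp : cos p != 0 by apply: contraTneq s1 => ->; rewrite mul0r mul0rn ltxx.
clearbody p; move: (cos p) (sin p) sp cp => c s s_n0 c_n0.
rewrite mulr2n [(c * s) *+ 2]mulr2n (_ : c * s + c * s = 2 * (c * s)); last by ring.
by field; rewrite s_n0 c_n0.
Qed.
End Chain.

(** * The function x cot x *)

Local Open Scope classical_set_scope.
Local Open Scope ring_scope.
Local Open Scope complex_scope.

Section Bounds.
Variable R : realType.
Implicit Types (x y : R) (f df : R -> R).

Lemma ge0_of_deriv f df : (forall x, is_derive x 1 f (df x)) -> f 0 = 0 ->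
  (forall x, 0 <= x -> 0 <= df x) -> forall x, 0 <= x -> 0 <= f x.
Proof.
move=> fd f0 df0 x x0.
have fc : {within `[0, x], continuous f}.
  by apply: derivable_within_continuous => y _; apply: ex_derive.
have [c] := MVT_segment x0 (fun y _ => fd y) fc.
rewrite in_itv /= => /andP[c0 _]; rewrite f0 !subr0 => ->.
by rewrite mulr_ge0 // df0.
Qed.

Lemma sin_le x : 0 <= x -> sin x <= x.
Proof.
move=> x0; rewrite -subr_ge0; move: x x0.
pose f (x : R) := x - sin x; pose df (x : R) := 1 - cos x.
have fd x : is_derive x 1 f (df x) by apply: is_derive_eq.
apply: (ge0_of_deriv fd) => [|x _]; first by rewrite /f sin0 subrr.
by rewrite /df subr_ge0 cos_le1.
Qed.

Lemma cos_ge x : 0 <= x -> 1 - x ^+ 2 / 2 <= cos x.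
Proof.
move=> x0; rewrite -subr_ge0; move: x x0.
pose f (x : R) := cos x - (1 - x ^+ 2 / 2); pose df (x : R) := x - sin x.
have fd x : is_derive x 1 f (df x).
  by apply: is_derive_eq; rewrite /df /GRing.scale /=; field.
apply: (ge0_of_deriv fd) => [|x x0]; first by rewrite /f cos0; field.
by rewrite /df subr_ge0 sin_le.
Qed.

Lemma sin_ge x : 0 <= x -> x - x ^+ 3 / 6 <= sin x.
Proof.
move=> x0; rewrite -subr_ge0; move: x x0.
pose f (x : R) := sin x - (x - x ^+ 3 / 6); pose df (x : R) := cos x - (1 - x ^+ 2 / 2).
have fd x : is_derive x 1 f (df x).
  by apply: is_derive_eq; rewrite /df /GRing.scale /=; field.
apply: (ge0_of_deriv fd) => [|x x0]; first by rewrite /f sin0; field.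
by rewrite /df subr_ge0 cos_ge.
Qed.

Lemma cos_le x : 0 <= x -> cos x <= 1 - x ^+ 2 / 2 + x ^+ 4 / 24.
Proof.
move=> x0; rewrite -subr_ge0; move: x x0.
pose f (x : R) := 1 - x ^+ 2 / 2 + x ^+ 4 / 24 - cos x.
pose df (x : R) := sin x - (x - x ^+ 3 / 6).
have fd x : is_derive x 1 f (df x).
  by apply: is_derive_eq; rewrite /df /GRing.scale /=; field.
apply: (ge0_of_deriv fd) => [|x x0]; first by rewrite /f cos0; field.
by rewrite /df subr_ge0 sin_ge.
Qed.

Lemma sin_le5 x : 0 <= x -> sin x <= x - x ^+ 3 / 6 + x ^+ 5 / 120.
Proof.
move=> x0; rewrite -subr_ge0; move: x x0.
pose f (x : R) := x - x ^+ 3 / 6 + x ^+ 5 / 120 - sin x.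
pose df (x : R) := 1 - x ^+ 2 / 2 + x ^+ 4 / 24 - cos x.
have fd x : is_derive x 1 f (df x).
  by apply: is_derive_eq; rewrite /df /GRing.scale /=; field.
apply: (ge0_of_deriv fd) => [|x x0]; first by rewrite /f sin0; field.
by rewrite /df subr_ge0 cos_le.
Qed.

Definition xcot x : R := x * cos x / sin x.

(** The Taylor bounds of order 5 for sin and 4 for cos put the numerator
    sin x (1 - x^2 / 3) - x cos x between 0 and x^5, and sin x >= x / 2. *)
Lemma xcot_approx x : 0 < x -> x <= 1 ->
  0 <= 1 - xcot x - x ^+ 2 / 3 <= 2 * x ^+ 4.
Proof.
move=> x0 x1; have x0' := ltW x0.
have sl : x / 2 <= sin x.
  apply: le_trans (sin_ge x0').
  have : x ^+ 3 <= x by rewrite exprS ler_piMr // exprn_ile1.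
  by lra.
have s0 : 0 < sin x by apply: lt_le_trans sl; rewrite divr_gt0.
have -> : 1 - xcot x - x ^+ 2 / 3 = (sin x * (1 - x ^+ 2 / 3) - x * cos x) / sin x.
  by rewrite /xcot; field; rewrite gt_eqF.
have q0 : 0 <= 1 - x ^+ 2 / 3.
  have : x ^+ 2 <= 1 by rewrite exprn_ile1.
  by lra.
have p5 : 0 <= x ^+ 5 by rewrite exprn_ge0.
have p7 : 0 <= x ^+ 7 by rewrite exprn_ge0.
have lo : 0 <= sin x * (1 - x ^+ 2 / 3) - x * cos x.
  have h1 := ler_wpM2r q0 (sin_ge x0'); have h2 := ler_wpM2l x0' (cos_le x0').
  rewrite subr_ge0; apply: le_trans h2 (le_trans _ h1).
  rewrite -subr_ge0 [X in 0 <= X](_ : _ = x ^+ 5 / 72); first by lra.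
  by field.
have up : sin x * (1 - x ^+ 2 / 3) - x * cos x <= x ^+ 5.
  have h1 := ler_wpM2r q0 (sin_le5 x0'); have h2 := ler_wpM2l x0' (cos_ge x0').
  apply: le_trans (lerB h1 h2) _.
  rewrite [X in X <= _](_ : _ = x ^+ 5 * 23 / 360 - x ^+ 7 / 360); first by lra.
  by field.
apply/andP; split; first by rewrite divr_ge0 // ltW.
rewrite ler_pdivrMr //; apply: le_trans up _.
have -> : x ^+ 5 = 2 * x ^+ 4 * (x / 2) by field.
by rewrite ler_wpM2l // mulr_ge0 // exprn_ge0.
Qed.

(** The derivative is (sin x cos x - x) / sin^2 x, and sin x cos x < sin x <= x. *)
Lemma xcot_decr x y : 0 < x -> x < y -> y < pi / 2 -> xcot y < xcot x.
Proof.
move=> x0 xy yp.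
have sp t : x <= t -> t <= y -> 0 < sin t.
  move=> xt ty; apply: sin_gt0_pi; rewrite (lt_le_trans x0 xt) /=.
  have := @pi_gt0 R; lra.
pose df (t : R) : R := (cos t * sin t - t) / sin t ^+ 2.
have fd t : sin t != 0 -> is_derive t 1 xcot (df t).
  move=> st; have dsi : is_derive t 1 (fun t => (sin t)^-1) (- sin t ^- 2 *: cos t).
    exact: is_deriveV.
  have -> : xcot = (fun t : R => t * cos t) * (fun t => (sin t)^-1) by [].
  apply: is_derive_eq; rewrite /df /GRing.scale /=.
  have e0 : t * (1 - (cos t ^+ 2 + sin t ^+ 2)) / sin t ^+ 2 = 0.
    by rewrite cos2Dsin2 subrr mulr0 mul0r.
  by rewrite -[RHS]addr0 -e0; field.
have fdi t : t \in `]x, y[ -> is_derive t 1 xcot (df t).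
  rewrite in_itv /= => /andP[xt ty].
  by apply: fd; rewrite gt_eqF // sp ?ltW.
have fc : {within `[x, y], continuous xcot}.
  apply: derivable_within_continuous => t; rewrite in_itv /= => /andP[xt ty].
  by apply: ex_derive; apply: fd; rewrite gt_eqF // sp.
have [c] := MVT xy fdi fc; rewrite in_itv /= => /andP[xc cy] e.
rewrite -subr_lt0 e pmulr_llt0 ?subr_gt0 // /df.
have sc := sp c (ltW xc) (ltW cy).
rewrite pmulr_llt0 ?invr_gt0 ?exprn_gt0 // subr_lt0.
apply: lt_le_trans (sin_le (ltW (lt_trans x0 xc))).
rewrite gtr_pMl // lt_neqAle cos_le1 andbT; apply: contraTneq sc => c1.
have := cos2Dsin2 c; rewrite c1 expr1n => /eqP.
by rewrite -subr_eq0 addrAC subrr add0r sqrf_eq0 => /eqP->; rewrite ltxx.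
Qed.

End Bounds.

(** * Monotonicity and asymptotics in N *)

Section Asymptotics.
Variable R : realType.

Definition Jval (N : nat) : R := (2 * N%:R)^-1 * cot (pi / (4 * N%:R)).

Lemma Jval_xcot N : Jval N = 2 / pi * xcot (pi / (4 * N%:R)).
Proof.
case: N => [|N]; first by rewrite /Jval /xcot !mulr0 !invr0 mulr0 !mul0r mulr0.
rewrite /Jval /xcot /cot; move: (cos _) (sin _)^-1 => c s.
have p0 : pi != 0 :> R by rewrite gt_eqF ?pi_gt0.
have n0 : N.+1%:R != 0 :> R by rewrite pnatr_eq0.
by move: n0 p0; move: (N.+1%:R) pi => n p n0 p0; field; rewrite n0.
Qed.

Lemma Jval_incr M N : (2 <= M)%N -> (M < N)%N -> Jval M < Jval N.
Proof.
move=> M2 MN; have M0 : (0 < M)%N by apply: ltnW.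
have N0 : (0 < N)%N by apply: leq_trans MN.
rewrite !Jval_xcot ltr_pM2l ?divr_gt0 ?pi_gt0 //; apply: xcot_decr.
- by rewrite divr_gt0 ?pi_gt0 // mulr_gt0 // ltr0n.
- by rewrite ltr_pM2l ?pi_gt0 // ltf_pV2 ?posrE ?mulr_gt0 ?ltr0n // ltr_pM2l // ltr_nat.
- by rewrite ltr_pM2l ?pi_gt0 // ltf_pV2 ?posrE ?mulr_gt0 ?ltr0n // -natrM ltr_nat (@leq_trans (4 * 1)) // leq_mul2l.
Qed.

(** The constants are those of [xcot_approx] at x = pi / (4 N), which lies below 1. *)
Lemma Jval_approx N : pi < N%:R :> R ->
  0 <= 2 / pi - Jval N - pi / (24 * N%:R ^+ 2) <= pi ^+ 3 / 64 * N%:R ^- 4.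
Proof.
move=> pN; have p0 := @pi_gt0 R; have n0 := lt_trans p0 pN.
set x : R := pi / (4 * N%:R); have x0 : 0 < x by rewrite divr_gt0 // mulr_gt0.
have x1 : x <= 1 by rewrite ler_pdivrMr ?mulr_gt0 //; lra.
have -> : 2 / pi - Jval N - pi / (24 * N%:R ^+ 2) = 2 / pi * (1 - xcot x - x ^+ 2 / 3).
  rewrite Jval_xcot -/x; move: (xcot x) => y; rewrite /x.
  move: (gt_eqF p0) (gt_eqF n0); move: pi (N%:R) => p n /negbT p1 /negbT n1.
  by field; rewrite n1.
have /andP[lo up] := xcot_approx x0 x1; apply/andP; split.
  by rewrite mulr_ge0 // divr_ge0 // ltW.
have -> : pi ^+ 3 / 64 * N%:R ^- 4 = 2 / pi * (2 * x ^+ 4).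
  rewrite /x; move: (gt_eqF p0) (gt_eqF n0).
  by move: pi (N%:R) => p n /negbT p1 /negbT n1; field; rewrite n1.
by rewrite ler_wpM2l // divr_ge0 // ltW.
Qed.

Lemma Jval_bigO (j : nat -> R) : (forall N, (2 <= N)%N -> j N = Jval N) ->
  (fun N : nat => 2 / pi - j N) =
  (fun N : nat => pi / (24 * N%:R ^+ 2)) +O_\oo (fun N : nat => (N%:R ^- 4 : R)).
Proof.
move=> jE; apply/eqaddOP; near=> k; near=> N.
have pN : pi < N%:R :> R by near: N; exact: nbhs_infty_gtr.
have /andP[lo up] := Jval_approx pN.
have N2 : (2 <= N)%N by near: N; exact: nbhs_infty_ge.
rewrite !fctE jE // ger0_norm // ger0_norm ?invr_ge0 ?exprn_ge0 //.
apply: le_trans up _; rewrite ler_wpM2r ?invr_ge0 ?exprn_ge0 //.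
Unshelve. all: end_near. Qed.

Lemma Jval_cvg : Jval N @[N --> \oo] --> (2 / pi : R).
Proof.
apply/cvgrPdist_le => e e0; near=> N.
have pN : pi < N%:R :> R by near: N; exact: nbhs_infty_gtr.
have p0 := @pi_gt0 R; have n0 := lt_trans p0 pN.
have /andP[lo up] := Jval_approx pN.
have eN : (pi / 24 + pi ^+ 3 / 64) / e < N%:R by near: N; exact: nbhs_infty_gtr.
have n1 : 1 <= N%:R :> R by rewrite ler1n -(@ltr0n R).
have q0 : 0 <= pi / (24 * N%:R ^+ 2) :> R by rewrite divr_ge0 ?mulr_ge0 ?exprn_ge0 // ltW.
rewrite ger0_norm; last by lra.
have i1 : N%:R ^- 2 <= N%:R^-1 :> R.
  by rewrite lef_pV2 ?posrE ?exprn_gt0 // ler_eXnr.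
have i2 : N%:R ^- 4 <= N%:R^-1 :> R.
  by rewrite lef_pV2 ?posrE ?exprn_gt0 // ler_eXnr.
have h1 : pi / (24 * N%:R ^+ 2) <= pi / 24 / N%:R :> R.
  by rewrite invfM mulrA ler_wpM2l // divr_ge0 // ltW.
have h2 : pi ^+ 3 / 64 * N%:R ^- 4 <= pi ^+ 3 / 64 / N%:R :> R.
  by rewrite ler_wpM2l // divr_ge0 // exprn_ge0 // ltW.
have h3 : pi / 24 / N%:R + pi ^+ 3 / 64 / N%:R <= e :> R.
  by rewrite -mulrDl ler_pdivrMr // [e * _]mulrC -ler_pdivrMr // ltW.
by lra.
Unshelve. all: end_near. Qed.

End Asymptotics.

Theorem theorem4p9 (R : realType) :
  (forall N : nat, (2 <= N)%N ->
     [/\ u_ R N = (N%:R^-1 * cot (pi / (2 * N%:R)))%:C,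
         v_ R N = (N%:R^-1 * csc (pi / (2 * N%:R)))%:C
       & J (K_ R N) (L_ R N) =
           ((2 * N%:R)^-1 * cot (pi / (4 * N%:R)))%:C])
  /\
  (let j (N : nat) : R := complex.Re (J (K_ R N) (L_ R N)) in
   [/\ forall M N : nat, (2 <= M)%N -> (M < N)%N -> j M < j N,
       j N @[N --> \oo] --> (2 / pi : R)
     & (fun N : nat => 2 / pi - j N) =
         (fun N : nat => pi / (24 * N%:R ^+ 2))
           +O_\oo (fun N : nat => (N%:R ^- 4 : R))]).
Proof.
have JN N : (2 <= N)%N -> J (K_ R N) (L_ R N) = (Jval R N)%:C.
  by case: N => [//|K] K0; apply: J_cot.
split.
  move=> N N2; split; last exact: JN.
    by case: N N2 => [//|K] K0; apply: u_cot.
  by case: N N2 => [//|K] _; apply: v_csc.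
move=> j; have jE N : (2 <= N)%N -> j N = Jval R N by move=> N2; rewrite /j JN.
split.
- move=> M N M2 MN; rewrite !jE //; first exact: Jval_incr.
  exact: leq_trans (ltnW MN).
- apply: cvg_trans (@Jval_cvg R); apply: near_eq_cvg.
  by exists 2%N => // N /= N2; rewrite jE.
- exact: Jval_bigO.
Qed.
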